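(* Let $A=A_0\oplus\mathsf{Y}A_1\oplus\cdots\oplus\mathsf{Y}^dA_d$, with $A_k\in\mathbb{R}_{\min}^{n\times n}$, be a regular min-plus matrix polynomial. Let $\mathcal{A}=\mathcal{A}_0+\mathsf{Y}\mathcal{A}_1+\cdots+\mathsf{Y}^d\mathcal{A}_d$ be a matrix polynomial with coefficients $\mathcal{A}_k\in\mathcal{C}^{n\times n}$ such that $(\mathcal{A}_{\epsilon,k})_{ij}\simeq(a_k)_{ij}\epsilon^{(A_k)_{ij}}$ for all $1\le i,j\le n$ and $0\le k\le d$, where $a_k\in\mathbb{C}^{n\times n}$. For every finite ($\neq\pm\infty$) algebraic eigenvalue $\gamma$ of $A$, let $m_{\gamma,A}$ be its multiplicity, let $m'_{\gamma,A}$ be the sum of the multiplicities of all the algebraic eigenvalues of $A$ greater than $\gamma$ ($+\infty$ included), and let $m''_{\gamma,A}=nd-m_{\gamma,A}-m'_{\gamma,A}$; let $G$ be equal either to $\operatorname{Opt}(\widehat A(\gamma))$ or to $\operatorname{Sat}(\widehat A(\gamma),U,V)$ for any choice of the Hungarian pair $(U,V)$ with respect to $\widehat A(\gamma)$, let $G_k=\mathcal{G}_k(A,\gamma)\cap G$, and let $$a^{(\gamma)}:=a_0^{G_0}+\mathsf{Y}a_1^{G_1}+\cdots+\mathsf{Y}^da_d^{G_d}.$$ Then, for generic values of the parameters $(a_k)_{ij}$, the matrix polynomial $\mathcal{A}$ is regular, all eigenvalues of $\mathcal{A}_\epsilon$ have first order asymptotics, and: (1) $\operatorname{val}P_{\mathcal{A}_\epsilon}=\operatorname{val}P_A$,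 which means that $+\infty$ is an eigenvalue of $A$ if and only if $0$ is an eigenvalue of $\mathcal{A}_\epsilon$, and they have the same multiplicity. (2) $\deg P_{\mathcal{A}_\epsilon}=\deg P_A$, which means that $-\infty$ is an eigenvalue of $A$ if and only if $\infty$ is an eigenvalue of $\mathcal{A}_\epsilon$, and they have the same multiplicity. (3) For any finite algebraic eigenvalue $\gamma$ of $A$, the matrix polynomial $a^{(\gamma)}$ is regular and has $m_{\gamma,A}$ non-zero eigenvalues. Moreover, $m'_{\gamma,A}=\operatorname{val}\det(a^{(\gamma)})$ is the multiplicity of $0$ as an eigenvalue of $a^{(\gamma)}$, and $m''_{\gamma,A}=nd-m_{\gamma,A}-m'_{\gamma,A}$ is the multiplicity of $\infty$ as an eigenvalue of $a^{(\gamma)}$, considered as a matrix polynomial of degree $d$.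
   Context: **Genericity.** A property $\mathscr{P}(y)$ of $y\in\mathbb{C}^N$ holds for generic values of $y$ if there is a non-zero polynomial $Q\in\mathbb{C}[\mathsf{Y}_1,\dots,\mathsf{Y}_N]$ such that $\mathscr{P}(y)$ is true whenever $Q(y)\ne0$. Here $A$ is fixed, $y$ is the family $((a_k)_{ij})_{0\le k\le d,\,1\le i,j\le n}$, and the property is that the conclusions hold for any $\mathcal{A}$ satisfying $(\mathcal{A}_{\epsilon,k})_{ij}\simeq(a_k)_{ij}\epsilon^{(A_k)_{ij}}$. **Germs and asymptotics.** $\mathcal{C}$ is the ring of germs at $0^+$ of continuous functions $f:(0,\epsilon_0)\to\mathbb{C}$ (some $\epsilon_0>0$) such that $|f(\epsilon)|\le\epsilon^{-k}$ on $(0,\epsilon_0)$ for some constant $k>0$ (functions coinciding near $0$ are identified). For $f\in\mathcal{C}$, $a\in\mathbb{C}$, $A\in\mathbb{R}\cup\{+\infty\}$: $f(\epsilon)\simeq a\epsilon^A$ means $\lim_{\epsilon\to0^+}\epsilon^{-A}f(\epsilon)=a$ if $A\in\mathbb{R}$, and $f=0$ (near $0$) if $A=+\infty$. One says that $f$ has first order asymptotics, $f\sim a\epsilon^A$, if $f\simeq a\epsilon^A$ and either $A\in\mathbb{R}$, $a\ne0$, or $A=+\infty$. $\mathcal{A}_{\epsilon,k}$ and $\mathcal{A}_\epsilon$ are the values at $\epsilon$ of $\mathcal{A}_k$ and $\mathcal{A}$. **Eigenvalues of matrix polynomials.** A matrix polynomial $\mathcal{A}=\sum_{k=0}^d\mathsf{Y}^k\mathcal{A}_k$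 of size $n$ (over $\mathcal{C}$ or $\mathbb{C}$) is regular if $\det\mathcal{A}$ is not identically zero. $P_{\mathcal{A}_\epsilon}:=\det(\mathcal{A}_\epsilon)$; its roots are the eigenvalues of $\mathcal{A}_\epsilon$, and if its degree is $<nd$, $\infty$ is also an eigenvalue, with multiplicity $nd$ minus the degree. Eigenvalues are counted with multiplicities. The assertion on first order asymptotics concerns the eigenvalues other than $\infty$. $\operatorname{val}$ and $\deg$ of a polynomial are the smallest and largest exponents with non-zero coefficient (coefficient $\ne+\infty$ in the min-plus case). **Min-plus algebra.** $\mathbb{R}_{\min}=\mathbb{R}\cup\{+\infty\}$ is the min-plus semifield: $a\oplus b=\min(a,b)$, product $ab=a+b$ (usual sum), zero $+\infty$, unit $0$. For a formal polynomial $P$ over $\mathbb{R}_{\min}$ of degree $N$, the function $\widehat P(y)=\min_k(P_k+ky)$ (the term $k=0$ being $P_0$) factors uniquely as $P_N+\sum_{i=1}^N\min(y,c_i)$ with $c_1\le\cdots\le c_N$ in $\mathbb{R}_{\min}$; the $c_i$ are the roots of $P$, with multiplicity the number of occurrences. For $B\in\mathbb{R}_{\min}^{n\times n}$, $|\sigma|_B=\sum_iB_{i\sigma(i)}$ for a permutation $\sigma$ of $[n]=\{1,\dots,n\}$, and $\operatorname{per}B=\min_\sigma|\sigma|_B$. For the min-plus matrix polynomial $A$, $P_A=\operatorname{per}A\in\mathbb{R}_{\min}[\mathsf{Y}]$ is the min-plus permanent of the matrix with entries $A_{ij}=\bigoplus_k(A_k)_{ij}\mathsf{Y}^k$; i.e.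 $(P_A)_\ell=\min\sum_i(A_{k_i})_{i\sigma(i)}$ over permutations $\sigma$ of $[n]$ and $k_1,\dots,k_n\in\{0,\dots,d\}$ with $\sum_i k_i=\ell$. $A$ is regular if $P_A$ is not identically $+\infty$. Then its algebraic eigenvalues are the roots of $P_A$; $+\infty$ is an eigenvalue with multiplicity $\operatorname{val}P_A$ when $\operatorname{val}P_A>0$; when $\deg P_A<nd$, one says that $-\infty$ is an eigenvalue with multiplicity $nd-\deg P_A$. $\widehat A(\gamma)\in\mathbb{R}_{\min}^{n\times n}$ is the matrix with entries $\widehat A_{ij}(\gamma)=\min_k((A_k)_{ij}+k\gamma)$. **Graphs.** All graphs are directed with node set $[n]$. For $B\in\mathbb{R}_{\min}^{n\times n}$ with $\operatorname{per}B\ne+\infty$: $\operatorname{Opt}(B)$ has an arc $(i,j)$ iff there is a permutation $\sigma$ with $j=\sigma(i)$ and $|\sigma|_B=\operatorname{per}B$. A Hungarian pair with respect to $B$ is a pair $U,V\in\mathbb{R}^n$ with $B_{ij}\ge U_i+V_j$ for all $i,j$ and $\sum_iU_i+\sum_jV_j=\operatorname{per}B$. $\operatorname{Sat}(B,U,V)$ has an arc $(i,j)$ iff $B_{ij}=U_i+V_j$. $\mathcal{G}_k(A,\gamma)$ has an arc $(i,j)$ iff $k\gamma+(A_k)_{ij}=\widehat A_{ij}(\gamma)\ne+\infty$. $G\cap G'$ is the graph whose arcs are the common arcs. For $b\in\mathbb{C}^{n\times n}$ and a graph $G$, $b^G$ is the matrix with $(b^G)_{ij}=b_{ij}$ if $(i,j)$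 is an arc of $G$ and $(b^G)_{ij}=0$ otherwise. *)

(* Defs.v *)
From HB Require Import structures.
From mathcomp Require Import all_boot all_order all_fingroup all_algebra.
From mathcomp Require Import all_classical all_reals all_analysis.
From mathcomp Require Import complex.
From mathcomp Require mpoly.
(* The notations of mpoly clash with those of all_analysis. *)
Import (canonicals) mpoly.

Set Implicit Arguments.
Unset Strict Implicit.
Unset Printing Implicit Defensive.

Import Order.TTheory GRing.Theory Num.Theory.
Import numFieldNormedType.Exports.

Local Open Scope classical_set_scope.
Local Open Scope ring_scope.
Local Open Scope complex_scope.

(* The N variables of Q are indexed by a finite type I with #|I| = N. *)
Definition generic (K : comNzRingType) (I : finType)
    (P : (I -> K) -> Prop) : Prop :=
  exists Q : mpoly.mpoly #|I| K, Q != 0 /\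
    forall y : I -> K, mpoly.meval (fun l => y (enum_val l)) Q != 0 -> P y.

(* Germs are handled through representatives f : R -> R[i], only the values of
   which on some interval (0, e0) matter. *)
Definition is_germ (R : realType) (f : R -> R[i]) : Prop :=
  exists e0 : R, 0 < e0 /\
    (forall e, 0 < e < e0 -> continuous_at e (f : R -> R[i]^o)) /\
    exists2 k : R, 0 < k & forall e, 0 < e < e0 -> `|f e| <= (e `^ (- k))%:C.

Definition asymp (R : realType) (f : R -> R[i]) (a : R[i]) (A : \bar R)
    : Prop :=
  match A with
  | r%:E => (e `^ (- r))%:C * f e @[e --> 0^'+] --> (a : R[i]^o)
  | +oo%E => \forall e \near 0^'+, f e = 0
  | -oo%E => False
  end.

Definition has_first_order_asymptotics (R : realType) (f : R -> R[i]) : Prop :=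
  exists (a : R[i]) (A : \bar R),
    asymp f a A /\ (A \is a fin_num /\ a != 0 \/ A = +oo%E).

(* Smallest exponent whose coefficient differs from the zero z of the
   coefficients (size s if there is none). *)
Definition valuation (T : eqType) (z : T) (s : seq T) : nat :=
  find (fun c => c != z) s.

Definition matpoly (K : nzRingType) (n d : nat) (a : 'I_d.+1 -> 'M[K]_n)
    : 'M[{poly K}]_n :=
  \sum_(k < d.+1) 'X^k *: map_mx polyC (a k).

Definition char_poly_of (K : comNzRingType) (n d : nat)
    (a : 'I_d.+1 -> 'M[K]_n) : {poly K} := \det (matpoly a).

(* The roots of p listed with multiplicity (meaningful when p != 0). *)
Definition poly_roots (K : closedFieldType) (p : {poly K}) : seq K :=
  sval (closed_field_poly_normal p).

Definition poly_deg (K : nzRingType) (p : {poly K}) : nat := (size p).-1.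

(* The eigenvalues other than oo; see mult_infty for the latter. *)
Definition eigenvalues (K : closedFieldType) (n d : nat)
    (a : 'I_d.+1 -> 'M[K]_n) : seq K := poly_roots (char_poly_of a).

Definition mult_infty (K : comNzRingType) (n d : nat)
    (a : 'I_d.+1 -> 'M[K]_n) : nat := (n * d - poly_deg (char_poly_of a))%N.

(* Value at e of a matrix polynomial whose coefficients have germ entries. *)
Definition matgerm_at (R : realType) (n d : nat)
    (F : 'I_d.+1 -> 'M[R -> R[i]]_n) (e : R) : 'I_d.+1 -> 'M[R[i]]_n :=
  fun k => map_mx (fun f => f e) (F k).

(* det F, as a polynomial over the ring of germs, is not the zero polynomial. *)
Definition regular_germ (R : realType) (n d : nat)
    (F : 'I_d.+1 -> 'M[R -> R[i]]_n) : Prop :=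
  ~ \forall e \near (0 : R)^'+, char_poly_of (matgerm_at F e) = 0.

(* Eigenvalues are elements of the ring of germs: the entries of l are continuous
   branches which, for e small enough, list all the finite eigenvalues of F at e
   with their multiplicities. *)
Definition eigenvalues_have_first_order_asymptotics (R : realType) (n d : nat)
    (F : 'I_d.+1 -> 'M[R -> R[i]]_n) : Prop :=
  exists l : seq (R -> R[i]),
    [/\ forall i, (i < size l)%N -> is_germ (nth (fun=> 0) l i),
        \forall e \near 0^'+,
          perm_eq (eigenvalues (matgerm_at F e)) [seq f e | f <- l]
      & forall i, (i < size l)%N ->
          has_first_order_asymptotics (nth (fun=> 0) l i)].

(* R_min is the set of x : \bar R with x != -oo. A formal min-plus polynomial
   is the sequence of its coefficients; those beyond the end, as well as
   possibly some of the last ones, are +oo. *)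

Definition mp_val (R : realType) (P : seq (\bar R)) : nat := valuation +oo%E P.

Definition mp_deg (R : realType) (P : seq (\bar R)) : nat :=
  \max_(k < size P | nth +oo%E P k != +oo%E) k.

(* Here +oo *+ 0 = 0, so that the term k = 0 is P_0 for all y. *)
Definition mp_eval (R : realType) (P : seq (\bar R)) (y : \bar R) : \bar R :=
  (\big[mine/+oo]_(k < size P) (nth +oo P k + y *+ k))%E.

Definition mp_factorization (R : realType) (P : seq (\bar R))
    (c : seq (\bar R)) : Prop :=
  [/\ size c = mp_deg P, sorted <=%O c, -oo%E \notin c &
      forall y : \bar R, y != -oo%E ->
        mp_eval P y = (nth +oo P (mp_deg P) + \sum_(x <- c) mine y x)%E].

(* The roots c_1 <= ... <= c_N of P, N = deg P (the factorization of a formal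
   min-plus polynomial exists and is unique). *)
Definition mp_roots (R : realType) (P : seq (\bar R)) : seq (\bar R) :=
  xget [::] [set c | mp_factorization P c].

Definition mp_weight (R : realType) (n : nat) (B : 'M[\bar R]_n) (s : 'S_n)
    : \bar R := (\sum_(i < n) B i (s i))%E.

Definition mp_per (R : realType) (n : nat) (B : 'M[\bar R]_n) : \bar R :=
  \big[mine/+oo%E]_(s : 'S_n) mp_weight B s.

Definition mp_charcoef (R : realType) (n d : nat)
    (A : 'I_d.+1 -> 'M[\bar R]_n) (l : nat) : \bar R :=
  \big[mine/+oo%E]_(s : 'S_n)
    \big[mine/+oo%E]_(k : {ffun 'I_n -> 'I_d.+1} | (\sum_(i < n) k i)%N == l)
      (\sum_(i < n) A (k i) i (s i))%E.

Definition mp_charpoly (R : realType) (n d : nat)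
    (A : 'I_d.+1 -> 'M[\bar R]_n) : seq (\bar R) :=
  mkseq (mp_charcoef A) (n * d).+1.

Definition mp_regular (R : realType) (n d : nat)
    (A : 'I_d.+1 -> 'M[\bar R]_n) : Prop :=
  exists l, mp_charcoef A l != +oo%E.

(* Multiplicity as an algebraic eigenvalue, 0 for a non-eigenvalue. *)
Definition mp_mult (R : realType) (n d : nat) (A : 'I_d.+1 -> 'M[\bar R]_n)
    (x : \bar R) : nat :=
  if x == -oo%E then (n * d - mp_deg (mp_charpoly A))%N
  else count_mem x (mp_roots (mp_charpoly A)).

(* Sum of the multiplicities of the eigenvalues greater than g, +oo included. *)
Definition mp_mult_gt (R : realType) (n d : nat) (A : 'I_d.+1 -> 'M[\bar R]_n)
    (g : R) : nat :=
  count (fun x => (g%:E < x)%E) (mp_roots (mp_charpoly A)).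

Definition mp_hat (R : realType) (n d : nat) (A : 'I_d.+1 -> 'M[\bar R]_n)
    (g : R) : 'M[\bar R]_n :=
  \matrix_(i, j) \big[mine/+oo%E]_(k < d.+1) (A k i j + (g *+ k)%:E)%E.

Definition Opt (R : realType) (n : nat) (B : 'M[\bar R]_n) : rel 'I_n :=
  fun i j => [exists s : 'S_n, (j == s i) && (mp_weight B s == mp_per B)].

Definition hungarian_pair (R : realType) (n : nat) (B : 'M[\bar R]_n)
    (U V : 'I_n -> R) : Prop :=
  (forall i j, ((U i + V j)%:E <= B i j)%E) /\
  ((\sum_(i < n) U i + \sum_(j < n) V j)%:E = mp_per B).

Definition Sat (R : realType) (n : nat) (B : 'M[\bar R]_n) (U V : 'I_n -> R)
    : rel 'I_n :=
  fun i j => B i j == (U i + V j)%:E.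

Definition graph_level (R : realType) (n d : nat)
    (A : 'I_d.+1 -> 'M[\bar R]_n) (g : R) (k : 'I_d.+1) : rel 'I_n :=
  fun i j => (((g *+ k)%:E + A k i j)%E == mp_hat A g i j)
             && (mp_hat A g i j != +oo%E).

Definition graph_cap (n : nat) (G G' : rel 'I_n) : rel 'I_n :=
  fun i j => G i j && G' i j.

Definition mx_restrict (K : nzRingType) (n : nat) (b : 'M[K]_n) (G : rel 'I_n)
    : 'M[K]_n :=
  \matrix_(i, j) if G i j then b i j else 0.

Definition a_gamma (R : realType) (n d : nat) (A : 'I_d.+1 -> 'M[\bar R]_n)
    (a : 'I_d.+1 -> 'M[R[i]]_n) (g : R) (G : rel 'I_n)
    : 'I_d.+1 -> 'M[R[i]]_n :=
  fun k => mx_restrict (a k) (graph_cap (graph_level A g k) G).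

(* Main.v *)
(* Fix a real slope [g] and let [v] be the minimum over all monomials of [det A]
   of weight plus [g] times exponent. The monomials supported in the graphs
   [G_k] are exactly those attaining [v] (for [Opt], because a Hungarian pair
   exists and every arc of an optimal permutation is saturated), so
   [e^-v * P_e(e^g * Y)] converges coefficientwise to [det a^(g)]. Concavity of
   the min-plus polynomial function identifies the extreme exponents of the
   active monomials with the numbers of roots [> g] and [>= g].
   For generic entries the extreme coefficients of [det a^(g)] do not vanish and
   its nonzero roots are simple: the determinant is affine in each entry, and a
   pencil [p + t * h] with [p] having simple nonzero roots keeps this property
   for all but finitely many [t]. Each simple root then continues uniquely to a
   continuous branch [e^g * (z + o(1))], and counting shows that these branches,
   together with the root [0], exhaust the eigenvalues. *)
Require Import Defs.
From mathcomp Require Import all_boot all_order all_fingroup all_algebra.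
From mathcomp Require Import all_classical all_reals all_analysis.
From mathcomp Require Import complex.
From mathcomp Require Import ring lra zify.
From mathcomp Require mpoly.
Import (canonicals) mpoly.

Set Implicit Arguments.
Unset Strict Implicit.
Unset Printing Implicit Defensive.

Import Order.TTheory GRing.Theory Num.Theory.
Import numFieldNormedType.Exports.

Local Open Scope classical_set_scope.
Local Open Scope ring_scope.
Local Open Scope complex_scope.

(** * Pencils of polynomials with simple roots *)

(** The delicate point of the genericity claim is that the polynomial witnessing it is nonzero. The
    resultant of a determinant with indeterminate entries is not expanded; instead, one point where
    it does not vanish is built. At the indicator point of a single monomial the determinant is plus
    or minus a power of X, which has no nonzero root at all. Each required condition is thus met
    somewhere, and conditions that persist along coordinate lines off finite sets can be met
    together. Since 0 may be a multiple root of [det a^(g)], the power of X is divided out before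
    the resultant is taken. The slopes used are not only the eigenvalues: one above all finite roots
    yields the valuation of [P_e], one below them yields its degree. Branches with different leading
    terms are eventually distinct, and this is what turns a count of roots into an equality of
    multisets. *)

Lemma poly_rootsE (K : closedFieldType) (p : {poly K}) :
  p = lead_coef p *: \prod_(z <- poly_roots p) ('X - z%:P).
Proof. exact: (svalP (closed_field_poly_normal p)). Qed.

Lemma mem_poly_roots (K : closedFieldType) (p : {poly K}) z :
  p != 0 -> (z \in poly_roots p) = root p z.
Proof.
by move=> p0; rewrite [in RHS](poly_rootsE p) rootZ ?lead_coef_eq0 // root_prod_XsubC.
Qed.

(** The root 0 is exempted because [det a^(g)] may vanish there to any order [m']. *)
Definition simple_nonzero_roots (K : nzRingType) (p : {poly K}) : Prop :=
  p != 0 /\ forall z, z != 0 -> root p z -> ~~ root p^`() z.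

(** In characteristic 0 the derivative of [p] vanishes at [z] to an order one less than [p] does, so
    the two sides can balance only if [h] vanishes at [z]. *)
Lemma wronskian_eq0_root (K : numFieldType) (p h : {poly K}) z :
  p != 0 -> p * h^`() = p^`() * h -> root p z -> root h z.
Proof.
move=> p0 W pz; have [[|m] [q /implyP/(_ p0) qz pE]] := multiplicity_XsubC p z.
  by rewrite pE expr0 mulr1 (negPf qz) in pz.
have Xm0 : ('X - z%:P) ^+ m != 0 :> {poly K} by rewrite expf_neq0 // polyXsubC_eq0.
have dE : p^`() = ('X - z%:P) ^+ m * (q^`() * ('X - z%:P) + q *+ m.+1).
  rewrite pE derivM deriv_exp derivXsubC mul1r /= mulrDr; congr (_ + _).
    by rewrite exprSr mulrCA.
  by rewrite !mulrnAr mulrC.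
move: W; rewrite dE {1}pE exprSr -[in RHS]mulrA mulrCA -mulrA => W.
have {W} := mulfI Xm0 W => /(congr1 (horner^~ z)).
rewrite !hornerE subrr !(mul0r, mulr0) add0r hornerMn -mulr_natr.
move/esym/eqP; rewrite !mulf_eq0 pnatr_eq0 orbF.
by rewrite -!rootE (negPf qz).
Qed.

(* The bad parameters come from the zeros of the Wronskian of [g] and [h], from
   the roots of [g], and from the single [t] that can kill the leading term. *)
Lemma simple_nonzero_roots_pencil (K : numClosedFieldType) (g h : {poly K}) :
  simple_nonzero_roots g ->
  exists s : seq K, forall t, t \notin s -> simple_nonzero_roots (g + t *: h).
Proof.
case=> g0 gs; pose W := g * h^`() - g^`() * h.
exists ([seq - g^`().[z] / h^`().[z] | z <- poly_roots g]
     ++ [seq - g.[z] / h.[z] | z <- poly_roots W]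
     ++ [:: - lead_coef g / h`_(size g).-1]) => t.
rewrite !mem_cat !negb_or => /and4P[t1 t2 t3 _].
have divE (a b : K) : b != 0 -> a + t * b = 0 -> t = - a / b.
  by move=> b0 /eqP; rewrite addrC addr_eq0 => /eqP<-; rewrite mulfK.
have p0 : g + t *: h != 0.
  apply: contra t3 => /eqP/polyP/(_ (size g).-1).
  rewrite coefD coefZ coef0 -lead_coefE => e.
  have [h0|h0] := eqVneq h`_(size g).-1 0; last by rewrite -(divE _ _ h0 e).
  by move: e; rewrite h0 mulr0 addr0 => /eqP; rewrite lead_coef_eq0 (negPf g0).
split=> // z z0 pz; apply/negP=> dpz.
move: (pz) (dpz); rewrite derivD derivZ !rootE !hornerE => /eqP gh /eqP dgh.
(* If [h] vanishes at [z], then [z] is a root of [g], simple by assumption, and the equation for the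
   derivatives determines [t]. *)
have [hz|hz] := eqVneq h.[z] 0.
  move: gh; rewrite hz mulr0 addr0 => gz.
  have gz' : g^`().[z] != 0 by apply: gs => //; apply/eqP.
  have [h'z|h'z] := eqVneq h^`().[z] 0.
    by move: dgh; rewrite h'z mulr0 addr0 => /eqP; rewrite (negPf gz').
  case/negP: t1; rewrite (divE _ _ h'z dgh); apply/mapP; exists z => //.
  by rewrite mem_poly_roots //; apply/eqP.
(* If [W = 0], the Wronskian of [g + t *: h] and [h] is zero too, which makes [z] a root of [h]. *)
have [W0|W0] := eqVneq W 0.
  have : root h z.
    apply: (wronskian_eq0_root p0) pz.
    rewrite derivD derivZ !mulrDl -!scalerAl [h * _]mulrC; congr (_ + _).
    by apply/eqP; rewrite -subr_eq0; apply/eqP.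
  by rewrite rootE (negPf hz).
(* Here [z] is a common root of [g + t *: h] and of its derivative, hence a root of [W]. *)
case/negP: t2; rewrite (divE _ _ hz gh); apply/mapP; exists z => //.
rewrite mem_poly_roots // rootE /W !hornerE.
have -> : g.[z] = - (t * h.[z]) by apply/eqP; rewrite -addr_eq0 gh.
have -> : g^`().[z] = - (t * h^`().[z]) by apply/eqP; rewrite -addr_eq0 dgh.
by apply/eqP; rewrite !mulNr opprK mulrAC addNr.
Qed.

(** * Conditions stable along coordinate lines *)

Definition upd (T : eqType) (K : Type) (y : T -> K) (e : T) (t : K) : T -> K :=
  fun x => if x == e then t else y x.

(** A substitute for Zariski openness that can be checked one entry at a time, which is how the
    affine dependence of the determinant on each entry is exploited. The finite exceptional set may
    depend on the point. *)
Definition line_open (T K : eqType) (P : (T -> K) -> Prop) : Prop :=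
  forall y e, P y -> exists s : seq K, forall t, t \notin s -> P (upd y e t).

Lemma line_open_and (T K : eqType) (P1 P2 : (T -> K) -> Prop) :
  line_open P1 -> line_open P2 -> line_open (fun y => P1 y /\ P2 y).
Proof.
move=> o1 o2 y e [/(o1 _ e)[s1 h1] /(o2 _ e)[s2 h2]]; exists (s1 ++ s2) => t.
by rewrite mem_cat negb_or => /andP[/h1 ? /h2 ?].
Qed.

Lemma exists_notin (K : numDomainType) (s : seq K) : exists t, t \notin s.
Proof.
pose S := \sum_(x <- s) `|x|.
have S0 : 0 <= S by exact: sumr_ge0.
exists (1 + S); apply/negP => H.
have: `|1 + S| <= S by rewrite [leRHS](big_rem _ H) /= lerDl sumr_ge0.
by rewrite ger0_norm ?addr_ge0 // gerDr ler10.
Qed.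

(* The coordinates of a point of [P1] and of a point of [P2] are made to agree
   one after the other. *)
Lemma line_open_meet (T : finType) (K : numDomainType)
    (P1 P2 : (T -> K) -> Prop) y1 y2 :
  line_open P1 -> line_open P2 -> P1 y1 -> P2 y2 ->
  exists y, P1 y /\ P2 y.
Proof.
move=> o1 o2 p1 p2.
suff H (r : seq T) : exists z1 z2, [/\ P1 z1, P2 z2 & {in r, z1 =1 z2}].
  have [z1 [z2 [q1 q2 e]]] := H (enum T); exists z1; split=> //.
  by have -> : z1 = z2 by apply/funext => x; apply: e; rewrite mem_enum.
elim: r => [|e r [z1 [z2 [q1 q2 E]]]]; first by exists y1, y2.
have [s1 h1] := o1 _ e q1; have [s2 h2] := o2 _ e q2.
have [t] := exists_notin (s1 ++ s2); rewrite mem_cat negb_or => /andP[t1 t2].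
exists (upd z1 e t), (upd z2 e t); split; [exact: h1 | exact: h2 |].
move=> x; rewrite in_cons /upd; case: eqP => //= _; exact: E.
Qed.

(** * Expansion of the determinant *)

Lemma matpoly_entry (K : nzRingType) n d (a : 'I_d.+1 -> 'M[K]_n) i j :
  matpoly a i j = \sum_(k < d.+1) 'X^k * (a k i j)%:P.
Proof. by rewrite /matpoly summxE; apply: eq_bigr => k _; rewrite !mxE. Qed.

Lemma char_poly_ofE (K : comNzRingType) n d (a : 'I_d.+1 -> 'M[K]_n) :
  char_poly_of a = \sum_(s : 'S_n) \sum_(k : {ffun 'I_n -> 'I_d.+1})
    ((-1) ^+ s * \prod_(i < n) a (k i) i (s i)) *: 'X^(\sum_(i < n) k i).
Proof.
apply: eq_bigr => s _.
under eq_bigr => i _ do rewrite matpoly_entry.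
rewrite bigA_distr_bigA big_distrr; apply: eq_bigr => k _ /=.
by rewrite big_split /= -expr_sum -rmorph_prod
  -mul_polyC rmorphM rmorph_sign /= mulrA [RHS]mulrAC.
Qed.

Lemma coef_char_poly_of (K : comNzRingType) n d (a : 'I_d.+1 -> 'M[K]_n) l :
  (char_poly_of a)`_l = \sum_(s : 'S_n)
    \sum_(k : {ffun 'I_n -> 'I_d.+1} | (\sum_(i < n) k i)%N == l)
      (-1) ^+ s * \prod_(i < n) a (k i) i (s i).
Proof.
rewrite char_poly_ofE coef_sum; apply: eq_bigr => s _.
rewrite coef_sum [RHS]big_mkcond; apply: eq_bigr => k _.
by rewrite coefZ coefXn eq_sym; case: eqP; rewrite (mulr1, mulr0).
Qed.

Lemma sum_expo_le n d (k : {ffun 'I_n -> 'I_d.+1}) : (\sum_(i < n) k i <= n * d)%N.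
Proof.
rewrite -[X in (_ <= X * _)%N]card_ord -sum_nat_const.
by apply: leq_sum => i _; rewrite -ltnS.
Qed.

Lemma size_char_poly_of (K : comNzRingType) n d (a : 'I_d.+1 -> 'M[K]_n) :
  (size (char_poly_of a) <= (n * d).+1)%N.
Proof.
apply/leq_sizeP => l ltl; rewrite coef_char_poly_of big1 // => s _.
by rewrite big1 // => k /eqP kl; move: ltl; rewrite -kl ltnNge sum_expo_le.
Qed.

(** A support [E] of triples (degree, row, column) stands for a slope together with a graph; there
    are only finitely many supports. *)
Definition coef_on (K : nzRingType) n d (E : {set 'I_d.+1 * 'I_n * 'I_n})
    (y : 'I_d.+1 * 'I_n * 'I_n -> K) : 'I_d.+1 -> 'M[K]_n :=
  fun k => \matrix_(i, j) if (k, i, j) \in E then y (k, i, j) else 0.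

Definition monomial_in n d (E : {set 'I_d.+1 * 'I_n * 'I_n}) (s : 'S_n)
    (k : {ffun 'I_n -> 'I_d.+1}) : bool := [forall i, (k i, i, s i) \in E].

Lemma prod_coef_on (K : comNzRingType) n d (E : {set 'I_d.+1 * 'I_n * 'I_n})
    (y : 'I_d.+1 * 'I_n * 'I_n -> K)
    (s : 'S_n) (k : {ffun 'I_n -> 'I_d.+1}) :
  \prod_(i < n) coef_on E y (k i) i (s i) =
    if monomial_in E s k then \prod_(i < n) y (k i, i, s i) else 0.
Proof.
case: ifP => [/forallP ks|/forallP ks].
  by apply: eq_bigr => i _; rewrite mxE ks.
have [i /negPf ki] : exists i, (k i, i, s i) \notin E.
  by apply/existsP; rewrite -negb_forall; apply/negP => /forallP.
by rewrite (bigD1 i) //= mxE ki mul0r.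
Qed.

(** Any other choice of permutation and degrees uses a triple outside the indicator set, because the
    triple in row [i] determines both the degree and the image of [i]. *)
Lemma coef_monomial_indicator (K : comNzRingType) n d
    (E : {set 'I_d.+1 * 'I_n * 'I_n}) (s : 'S_n)
    (k : {ffun 'I_n -> 'I_d.+1}) :
  monomial_in E s k ->
  char_poly_of (coef_on E
    (fun x => (x \in [set (k i, i, s i) | i : 'I_n])%:R : K))
  = (-1) ^+ s *: 'X^(\sum_(i < n) k i).
Proof.
move=> sk.
pose y x : K := (x \in [set (k i, i, s i) | i : 'I_n])%:R; rewrite -/y.
rewrite char_poly_ofE (bigD1 s) //= (bigD1 k) //=.
have y0 s' k' : (s', k') != (s, k) -> \prod_(i < n) coef_on E y (k' i) i (s' i) = 0.
  move=> ne; rewrite prod_coef_on; case: ifP => // _.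
  have [i ski] : exists i, (k' i, i, s' i) \notin [set (k i, i, s i) | i : 'I_n].
    apply/existsP; rewrite -negb_forall; apply: contra ne => /forallP H.
    have {}H i : (k' i = k i) /\ (s' i = s i).
      by have /imsetP[j _ [-> -> ->]] := H i.
    by apply/eqP; congr (_, _); [apply/permP | apply/ffunP] => i; case: (H i).
  by rewrite (bigD1 i) //= /y (negPf ski) mul0r.
rewrite prod_coef_on sk [X in _ * X]big1 => [|i _]; last by rewrite /y imset_f.
rewrite mulr1 [X in _ + X + _]big1 => [|k' ne]; last first.
  by rewrite y0 ?mulr0 ?scale0r //; apply: contra ne => /eqP[->].
rewrite addr0 [X in _ + X]big1 ?addr0 // => s' ne; rewrite big1 // => k' _.
by rewrite y0 ?mulr0 ?scale0r //; apply: contra ne => /eqP[->].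
Qed.

(** Multilinearity in row [i0]: in the determinant [h] that row is reduced to ['X^k0] in column
    [j0], or to 0 if the updated entry lies outside [E]. *)
Lemma char_poly_of_upd (K : comNzRingType) n d
    (E : {set 'I_d.+1 * 'I_n * 'I_n}) (y : 'I_d.+1 * 'I_n * 'I_n -> K) e :
  exists h, forall t, char_poly_of (coef_on E (upd y e t))
    = char_poly_of (coef_on E y) + (t - y e) *: h.
Proof.
case: e => [[k0 i0] j0].
exists (\det (\matrix_(i, j) if i == i0 then
  (if (j == j0) && ((k0, i0, j0) \in E) then 'X^k0 else 0)
  else matpoly (coef_on E y) i j)) => t.
(* The right-hand side takes the form [b * det B + c * det C] with [b = 1]. *)
rewrite -[char_poly_of (coef_on E y)]mul1r -mul_polyC.
apply: (determinant_multilinear (i0 := i0)).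
- apply/rowP => j; rewrite !mxE !matpoly_entry eqxx mul1r.
  have [->|jj] := eqVneq j j0; last first.
    rewrite mulr0 addr0; apply: eq_bigr => k _; rewrite !mxE /upd.
    by case: eqP => // -[_ jj']; rewrite jj' eqxx in jj.
  rewrite (bigD1 k0) //= [in RHS](bigD1 k0) //= [LHS]addrC [RHS]addrAC [RHS]addrC.
  congr (_ + _).
    apply: eq_bigr => k kk; rewrite !mxE /upd.
    by case: eqP => // -[kk']; rewrite kk' eqxx in kk.
  rewrite !mxE /upd eqxx; case: ifP => _; last by rewrite !mulr0 addr0.
  by rewrite [in X in _ + X]mulrC -mulrDr -polyCD addrC subrK.
- apply/matrixP => i j; rewrite !mxE !matpoly_entry.
  apply: eq_bigr => k _; rewrite !mxE /upd.
  by case: eqP => // -[_ ii _]; have := neq_lift i0 i; rewrite ii eqxx.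
- apply/matrixP => i j; rewrite !mxE eq_sym (negPf (neq_lift _ _)) !matpoly_entry.
  apply: eq_bigr => k _; rewrite !mxE /upd.
  by case: eqP => // -[_ ii _]; have := neq_lift i0 i; rewrite ii eqxx.
Qed.

(** * Genericity *)

Lemma generic_forall (K : idomainType) (I X : finType) (P : X -> (I -> K) -> Prop) :
  (forall x, generic (P x)) -> generic (fun y => forall x, P x y).
Proof.
move=> /choice[Q PQ]; exists (\prod_x Q x); split.
  by apply/prodf_neq0 => x _; case: (PQ x).
move=> y; rewrite rmorph_prod /= => /prodf_neq0 H x.
by case: (PQ x) => _; apply; exact: H.
Qed.

(* [map_resultant] only covers morphisms out of a polynomial ring. *)
Lemma map_resultant_lead (aR rR : nzRingType) (f : {rmorphism aR -> rR}) (p q : {poly aR}) :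
  f (lead_coef p) != 0 -> f (lead_coef q) != 0 ->
  f (resultant p q) = resultant (map_poly f p) (map_poly f q).
Proof.
move=> fp fq; rewrite /resultant /Sylvester_mx !size_map_poly_id0 //.
rewrite -det_map_mx map_col_mx; congr (\det (col_mx _ _));
  by apply: map_lin1_mx => v; rewrite map_poly_rV rmorphM /= map_rVpoly.
Qed.

Lemma resultant_deriv_neq0 (K : numClosedFieldType) (p : {poly K}) : p != 0 ->
  (resultant p p^`() != 0) <-> (forall z, root p z -> ~~ root p^`() z).
Proof.
move=> p0; rewrite resultant_eq0 -leqNgt.
have g0 : gcdp p p^`() != 0 by rewrite gcdp_eq0 (negPf p0).
split=> [sz|H].
  by apply/Pdiv.ClosedField.coprimepP; rewrite coprimep_def eqn_leq sz size_poly_gt0.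
have : coprimep p p^`() by apply/Pdiv.ClosedField.coprimepP.
by rewrite coprimep_def => /eqP->.
Qed.

(** Division by ['X^l1] removes the root 0 and leaves a polynomial of known size. It is applied both
    with indeterminate entries and after evaluation, so that the two quotients have the same
    size. *)
Lemma extreme_coefs_drop (K : nzRingType) (p : {poly K}) l1 l2 :
  (forall l, p`_l != 0 -> (l1 <= l <= l2)%N) ->
  p`_l2 != 0 -> 
  [/\ p = drop_poly l1 p * 'X^l1, size (drop_poly l1 p) = (l2 - l1).+1
    & lead_coef (drop_poly l1 p) = p`_l2].
Proof.
move=> pl p2; have /andP[l12 _] := pl _ p2.
have sp : size p = l2.+1.
  apply/anti_leq/andP; split.
    apply/leq_sizeP => j lj; apply/eqP; apply: contraTT lj => /pl/andP[_].
    by rewrite -ltnNge ltnS.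
  by rewrite ltnNge; apply: contra p2 => /leq_sizeP ->.
have sd : size (drop_poly l1 p) = (l2 - l1).+1.
  by rewrite size_drop_poly sp subSn.
split=> //.
  rewrite -[LHS](poly_take_drop l1) (_ : take_poly l1 p = 0) ?add0r //.
  apply/polyP => i; rewrite coef_take_poly coef0; case: ltnP => // il.
  by apply/eqP; apply: contraTT il => /pl/andP[+ _]; rewrite -leqNgt.
by rewrite lead_coefE sd coef_drop_poly /= subnK.
Qed.

(** At a nonzero root [z] of the quotient [D], the product rule leaves only [D'(z) * z^l1]; and 0 is
    not a root of [D], whose constant term is the coefficient of index [l1] of [p]. *)
Lemma simple_nonzero_roots_drop (K : numClosedFieldType) (p : {poly K}) l1 l2 :
  (forall l, p`_l != 0 -> (l1 <= l <= l2)%N) -> p`_l1 != 0 -> p`_l2 != 0 ->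
  simple_nonzero_roots p <->
  (forall z, root (drop_poly l1 p) z -> ~~ root (drop_poly l1 p)^`() z).
Proof.
move=> pl p1 p2; have [pE _ _] := extreme_coefs_drop pl p2.
set D := drop_poly l1 p in pE *.
have D0 : D.[0] != 0 by rewrite horner_coef0 coef_drop_poly add0n.
have rE z : z != 0 -> (root p z = root D z) * (root D z -> root p^`() z = root D^`() z).
  move=> z0; have zl : (z ^+ l1 == 0) = false by rewrite expf_eq0 (negPf z0) andbF.
  split; first by rewrite pE rootM [X in _ || X]rootE hornerXn zl orbF.
  by rewrite !rootE pE derivM !hornerE => /eqP->; rewrite mul0r addr0 mulf_eq0 zl orbF.
split=> [[_ ps] z Dz | Ds].
  have z0 : z != 0 by apply: contraTneq Dz => ->; rewrite rootE.
  by rewrite -(rE z z0).2 // ps // (rE z z0).1.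
split=> [|z z0].
  by apply: contraNneq p2 => ->; rewrite coef0.
by rewrite (rE z z0).1 => Dz; rewrite (rE z z0).2 // Ds.
Qed.

Lemma coef_on_range (K : comNzRingType) n d (E : {set 'I_d.+1 * 'I_n * 'I_n})
    (y : 'I_d.+1 * 'I_n * 'I_n -> K) l1 l2 l :
  (forall (s : 'S_n) k, monomial_in E s k -> (l1 <= \sum_(i < n) k i <= l2)%N) ->
  (char_poly_of (coef_on E y))`_l != 0 -> (l1 <= l <= l2)%N.
Proof.
move=> El; apply: contraNT => lN; rewrite coef_char_poly_of big1 // => s _.
rewrite big1 // => k /eqP kl; rewrite prod_coef_on.
by case: ifP => [/El|_]; rewrite ?mulr0 // kl (negPf lN).
Qed.

Lemma line_open_coef (K : numFieldType) n d (E : {set 'I_d.+1 * 'I_n * 'I_n}) l :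
  line_open (fun y : 'I_d.+1 * 'I_n * 'I_n -> K =>
    (char_poly_of (coef_on E y))`_l != 0).
Proof.
move=> y e yl; have [h hE] := char_poly_of_upd E y e.
pose c := (char_poly_of (coef_on E y))`_l; pose w := h`_l.
have [w0|w0] := eqVneq w 0.
  by exists [::] => t _; rewrite hE coefD coefZ -/w w0 mulr0 addr0.
exists [:: y e - c / w] => t; rewrite mem_seq1 hE coefD coefZ -/c -/w; apply: contra.
rewrite addrC addr_eq0 => /eqP tw.
by rewrite -[t](subrK (y e)) -[t - _](mulfK w0) tw mulNr addrC.
Qed.

Lemma line_open_simple (K : numClosedFieldType) n d (E : {set 'I_d.+1 * 'I_n * 'I_n}) :
  line_open (fun y : 'I_d.+1 * 'I_n * 'I_n -> K =>
    simple_nonzero_roots (char_poly_of (coef_on E y))).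
Proof.
move=> y e ys; have [h hE] := char_poly_of_upd E y e.
have [s sP] := simple_nonzero_roots_pencil h ys.
exists [seq y e + t | t <- s] => t ts; rewrite hE; apply: sP.
by apply: contra ts => ts; apply/mapP; exists (t - y e) => //; rewrite addrC subrK.
Qed.

(** The witness is the product of the two extreme coefficients of the determinant with indeterminate
    entries and of a resultant testing simplicity. Indicator points satisfy the conditions
    separately, [line_open_meet] satisfies them jointly, and so the witness is nonzero. *)
Lemma generic_extremes (K : numClosedFieldType) n d
    (E : {set 'I_d.+1 * 'I_n * 'I_n}) :
  generic (fun y : 'I_d.+1 * 'I_n * 'I_n -> K =>
    forall (s1 s2 : 'S_n) k1 k2, monomial_in E s1 k1 -> monomial_in E s2 k2 ->
    (forall (s : 'S_n) k, monomial_in E s k ->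
       (\sum_(i < n) k1 i <= \sum_(i < n) k i <= \sum_(i < n) k2 i)%N) ->
    let p := char_poly_of (coef_on E y) in
    [/\ p`_(\sum_(i < n) k1 i) != 0, p`_(\sum_(i < n) k2 i) != 0
      & simple_nonzero_roots p]).
Proof.
(* Without a pair of extremal monomials the claim is vacuous and the polynomial 1 serves; otherwise
   the pair fixes [l1] and [l2]. *)
have [[[[[s1 s2] k1] k2] [E1 [E2 E12]]]|H] := pselect (exists x : 'S_n * 'S_n *
    {ffun 'I_n -> 'I_d.+1} * {ffun 'I_n -> 'I_d.+1},
    let: (s1, s2, k1, k2) := x in
    monomial_in E s1 k1 /\ monomial_in E s2 k2 /\
    forall (s : 'S_n) k, monomial_in E s k ->
       (\sum_(i < n) k1 i <= \sum_(i < n) k i <= \sum_(i < n) k2 i)%N); last first.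
  exists 1; split; first exact: oner_neq0.
  move=> y _ s1 s2 k1 k2 E1 E2 E12; case: H.
  by exists (s1, s2, k1, k2).
set l1 := (\sum_(i < n) k1 i)%N in E12; set l2 := (\sum_(i < n) k2 i)%N in E12.
set T := ('I_d.+1 * 'I_n * 'I_n)%type.
pose X (x : T) : mpoly.mpoly #|{: T}| K := mpoly.mpolyX K (mpoly.mnm1 (enum_rank x)).
pose P := char_poly_of (coef_on E X).
pose ev (y : T -> K) : {rmorphism mpoly.mpoly #|{: T}| K -> K} :=
  mpoly.meval (fun l => y (enum_val l)).
have evP y : map_poly (ev y) P = char_poly_of (coef_on E y).
  rewrite /P /char_poly_of -det_map_mx; congr (\det _).
  apply/matrixP => i j; rewrite !mxE !matpoly_entry rmorph_sum.
  apply: eq_bigr => k _; rewrite rmorphM /= map_polyXn map_polyC !mxE /=.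
  by congr (_ * _%:P); case: ifP => _; rewrite ?rmorph0 // mpoly.mevalXU enum_rankK.
have cevP y l : (char_poly_of (coef_on E y))`_l = ev y P`_l.
  by rewrite -evP coef_map.
pose D := drop_poly l1 P.
have mapD y : map_poly (ev y) D = drop_poly l1 (char_poly_of (coef_on E y)).
  by apply/polyP => l; rewrite coef_map !coef_drop_poly cevP.
have rangeE (L : comNzRingType) (y : T -> L) l :
  (char_poly_of (coef_on E y))`_l != 0 -> (l1 <= l <= l2)%N.
  exact: coef_on_range.
have l12 : (l1 <= l2)%N by case/andP: (E12 _ _ E2).
(* For [l1 = l2] the quotient [D] is constant, without roots, and its derivative has no leading
   coefficient to follow through evaluation; hence the factor 1. *)
pose Q := P`_l1 * P`_l2 * (if l1 == l2 then 1 else resultant D D^`()).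
have indic (s : 'S_n) k : monomial_in E s k -> exists y : T -> K, [/\ 
   (char_poly_of (coef_on E y))`_(\sum_i k i) != 0 &
   simple_nonzero_roots (char_poly_of (coef_on E y))].
  move=> /(@coef_monomial_indicator K) e; exists (fun x : T => (x \in [set (k i, i, s i) | i : 'I_n])%:R).
  rewrite e coefZ coefXn eqxx mulr1 signr_eq0; split=> //.
  (* A power of X has no nonzero root, so simplicity holds vacuously. *)
  split=> [|z z0]; first by rewrite scaler_eq0 signr_eq0 -size_poly_eq0 size_polyXn.
  by rewrite rootZ ?signr_eq0 // rootE hornerXn expf_eq0 (negPf z0) andbF.
have QP y : ev y Q != 0 <-> [/\ (char_poly_of (coef_on E y))`_l1 != 0,
   (char_poly_of (coef_on E y))`_l2 != 0 &
   simple_nonzero_roots (char_poly_of (coef_on E y))].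
  rewrite /Q !rmorphM /= !mulf_eq0 !negb_or -!cevP.
  set p := char_poly_of _.
  have [p1|p1] /= := boolP (p`_l1 != 0); last by split=> // -[].
  have [p2|p2] /= := boolP (p`_l2 != 0); last by split=> // -[].
  have pl l : p`_l != 0 -> (l1 <= l <= l2)%N by exact: rangeE.
  have [pE sD lD] := extreme_coefs_drop pl p2.
  have P2 : P`_l2 != 0 by apply: contraNneq p2 => P2; rewrite /p cevP P2 rmorph0.
  have [PE sD' lD'] := extreme_coefs_drop (rangeE _ X) P2.
  have simpleE := simple_nonzero_roots_drop pl p1 p2.
  suff H : (ev y (if l1 == l2 then 1 else resultant D D^`()) != 0) <->
     simple_nonzero_roots p.
     by split=> [/H ps|[_ _ /H]].
  rewrite simpleE; have [ll|ll] := eqVneq l1 l2.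
    rewrite rmorph1 oner_neq0; split=> // _ z.
    move: sD; rewrite ll subnn => /eqP/size_poly1P[c c0 ->].
    by rewrite rootC (negPf c0).
  rewrite map_resultant_lead.
  - rewrite -deriv_map mapD resultant_deriv_neq0 //.
    by rewrite -size_poly_eq0 sD.
  - by rewrite lD' -cevP.
  - have lt12 : (0 < l2 - l1)%N by rewrite subn_gt0 ltn_neqAle ll.
    (* The top coefficient of the derivative is [l2 - l1] times that of [D]. Being nonzero after
       evaluation, it was nonzero before, which also fixes the size of the derivative. *)
    have cD' : ev y (D^`())`_(l2 - l1).-1 != 0.
      rewrite coef_deriv prednK // rmorphMn /= coef_drop_poly subnK // -cevP.
      by rewrite mulrn_eq0 negb_or -lt0n lt12.
    rewrite lead_coefE; suff -> : size D^`() = (l2 - l1)%N by [].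
    apply/anti_leq/andP; split.
      by rewrite -ltnS -sD' lt_size_deriv // -size_poly_eq0 sD'.
    rewrite -[X in (X <= _)%N]prednK // ltnNge; apply: contra cD' => /leq_sizeP->//.
    by rewrite rmorph0.
exists Q; split; last first.
  move=> y Qy t1 t2 h1 h2 Et1 Et2 Eh /=.
  have -> : (\sum_(i < n) h1 i)%N = l1.
    by apply/anti_leq/andP; split; [case/andP: (Eh _ _ E1) | case/andP: (E12 _ _ Et1)].
  have -> : (\sum_(i < n) h2 i)%N = l2.
    by apply/anti_leq/andP; split; [case/andP: (E12 _ _ Et2) | case/andP: (Eh _ _ E2)].
  exact/QP.
have [y1 [c1 _]] := indic _ _ E1; have [y2 [c2 s2']] := indic _ _ E2.
have o1 := @line_open_coef K n d E l1; have o2 := @line_open_coef K n d E l2.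
have o3 := @line_open_simple K n d E.
have [y3 y3P] := line_open_meet o1 o2 c1 c2.
have [y [[yc1 yc2] ys]] := line_open_meet (line_open_and o1 o2) o3 y3P s2'.
by apply: contra_neq (iffRL (QP y) _) => // ->; rewrite rmorph0.
Qed.

(** * Newton polygon factorization of min-plus polynomials *)

Lemma bigmin_attained (R : realType) (I : finType) (F : I -> \bar R) (P : pred I) v i0 :
  P i0 -> F i0 = v -> (forall i, P i -> (v <= F i)%E) ->
  \big[mine/+oo%E]_(i | P i) F i = v.
Proof.
move=> Pi0 Fi0 H; apply/le_anti/andP; split.
  by rewrite -Fi0; apply: bigmin_le_cond.
by apply: le_bigmin => //; rewrite leey.
Qed.

Lemma ereal_mulrn_neqNy (R : realType) (y : \bar R) k : y != -oo%E -> (y *+ k)%E != -oo%E.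
Proof.
case: y => [r|_|] // ; first by rewrite -EFin_natmul.
by case: k => // k; rewrite enatmul_pinfty.
Qed.

(** The last edge of the Newton polygon: [a] is the least value of [(p k - p N) / (N - k)], which
    will be the smallest root, and [k0] attains it. *)
Lemma mp_newton_step (R : realType) N (p : nat -> \bar R) :
  (forall k, p k != -oo%E) -> p N != +oo%E ->
  (exists2 k, (k < N)%N & p k != +oo%E) ->
  exists a k0, [/\ (k0 < N)%N, p N = (p k0 + (- (a *+ (N - k0)))%:E)%E &
    forall k, (k <= N)%N -> (p N + (a *+ (N - k))%:E <= p k)%E].
Proof.
move=> pNy; case pN : (p N) (pNy N) => [b| |] // _ _ [k1 k1N pk1].
pose slope (i : 'I_N) : R := (fine (p i) - b) / (N - i)%:R.
have pk1' : p (Ordinal k1N) != +oo%E by [].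
case: (arg_minP (P := fun i : 'I_N => p i != +oo%E) slope pk1') => k0 pk0 k0min.
have N0 (i : 'I_N) : (N - i)%:R != 0 :> R by rewrite pnatr_eq0 subn_eq0 -ltnNge.
exists (slope k0), k0; split=> //.
  case pk0E : (p k0) (pNy k0) pk0 => [c| |] // _ _.
  rewrite -EFinD; congr EFin; rewrite /slope -[_ *+ (N - k0)]mulr_natr.
  by rewrite mulfVK // pk0E /=; ring.
move=> k; rewrite leq_eqVlt => /predU1P[->|kN]; first by rewrite subnn mulr0n pN adde0.
case pkE : (p k) (pNy k) => [c| |] // _; last by rewrite leey.
have := k0min (Ordinal kN); rewrite /= pkE => /(_ isT).
rewrite {2}/slope /= pkE /= ler_pdivlMr ?ltr0n ?subn_gt0 // mulr_natr.
by rewrite lee_fin lerBrDl.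
Qed.

(** For [r <= a] the last term wins, in the polynomial truncated at [k0] and, taking [k0 := N], in
    [p] itself. For [a <= r], treated by [newton_upper], the term at [k0] beats all later ones. *)
Lemma newton_lower (R : realDomainType) (a r b bk k k0 N : R) :
  b + a * (N - k) <= bk -> r <= a -> k <= k0 ->
  b + r * k0 <= bk - a * (N - k0) + r * k.
Proof.
rewrite -[r <= a]subr_ge0 -[k <= k0]subr_ge0 => h1 h2 h3.
have := mulr_ge0 h2 h3; lra.
Qed.

Lemma newton_upper (R : realDomainType) (a r b bk k k0 N : R) :
  b - a * (N - k0) + a * (N - k) <= bk -> a <= r -> k0 <= k ->
  b + r * k0 <= bk + r * k.
Proof.
rewrite -[a <= r]subr_ge0 -[k0 <= k]subr_ge0 => h1 h2 h3.
have := mulr_ge0 h2 h3; lra.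
Qed.

(** Induction on the degree by removal of the last edge, which contributes [N - k0] copies of [a];
    the other roots are those of the truncation at [k0]. *)
Lemma mp_newton_factorization (R : realType) N (p : nat -> \bar R) :
  (forall k, p k != -oo%E) -> p N != +oo%E ->
  exists c : seq (\bar R), [/\ size c = N, -oo%E \notin c & forall y : \bar R, y != -oo%E ->
    \big[mine/+oo%E]_(k < N.+1) (p k + y *+ k)%E = (p N + \sum_(x <- c) mine y x)%E].
Proof.
have [m] := ubnP N; elim: m N p => // m IH N p /ltnSE Nm pNy pN.
have [H|H] := pselect (exists2 k, (k < N)%N & p k != +oo%E); last first.
  exists (nseq N +oo%E); split; first by rewrite size_nseq.
    by rewrite mem_nseq andbF.
  move=> y yN; rewrite big_nseq; set s := iter _ _ _.
  have -> : s = (y *+ N)%E.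
    rewrite /s; elim: (N) => //= j ->.
    by rewrite miney -mulrS; case: j.
  apply: (@bigmin_attained _ _ _ _ _ ord_max) => //= i _.
  have := ltn_ord i; rewrite ltnS leq_eqVlt => /predU1P[->//|iN].
  have -> : p i = +oo%E by apply/eqP; apply: contrapT => /negP pi; apply: H; exists i.
  by rewrite addye ?leey // ereal_mulrn_neqNy.
have [a [k0 [k0N pNE ple]]] := mp_newton_step pNy pN H.
(* The shift gives the truncation the top coefficient [p N], so that both factorizations start with
   the same constant. *)
pose Q k := (p k + (- (a *+ (N - k0)))%:E)%E.
have QNy k : Q k != -oo%E.
  by rewrite /Q; case: (p k) (pNy k).
have Qk0 : Q k0 = p N by rewrite pNE.
have := IH k0 Q (leq_trans k0N Nm) QNy; rewrite Qk0 => /(_ pN)[c [sc cN cE]].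
exists (nseq (N - k0) a%:E ++ c); split.
- by rewrite size_cat size_nseq sc subnK // ltnW.
- by rewrite mem_cat mem_nseq negb_or andbF.
move=> y yN; rewrite big_cat big_nseq /=; set s := iter _ _ _.
have sE : s = (mine y a%:E *+ (N - k0))%E.
  by rewrite /s; elim: (N - k0)%N => //= j ->; rewrite -mulrS; case: j.
have real_p k : p k = +oo%E \/ exists b, p k = b%:E.
  by case: (p k) (pNy k) => [b| |] // _; [right; exists b | left].
have [b pNb] : exists b, p N = b%:E by case: (real_p N) pN => // ->.
have [b0 pk0] : exists b, p k0 = b%:E.
  by case: (real_p k0) => // e; move: pNE pNb; rewrite e => ->.
have bE : b = b0 - a *+ (N - k0).
  by apply/EFin_inj; rewrite -pNb pNE pk0.
have leN k bk : (k <= N)%N -> p k = bk%:E -> b + a * (N%:R - k%:R) <= bk.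
  move=> kN pk; have := ple k kN; rewrite pNb pk lee_fin.
  by rewrite -[a *+ _]mulr_natr natrB.
have bE' : b = b0 - a * (N%:R - k0%:R) by rewrite bE -[a *+ _]mulr_natr natrB // ltnW.
(* For [y <= a] the last terms of [Q] and of [p] are minimal. For [y > a] the terms of [p] beyond
   [k0] are dominated by the one at [k0], and the others are those of [Q] shifted back. *)
have [ya|ay] := leP y a%:E.
  have [r yr] : exists r, y = r%:E by case: y yN ya {cE sE s} => [r| |] // _ _; exists r.
  move: ya; rewrite yr lee_fin => ra.
  have min_l : mine r%:E a%:E = r%:E by apply/min_idPl; rewrite lee_fin.
  have -> : s = (r *+ (N - k0))%:E by rewrite sE yr min_l EFin_natmul.
  have := cE _ yN; rewrite (bigmin_attained (v := (b + r *+ k0)%:E) (i0 := ord_max)) //; last 2 first.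
  - by rewrite /= Qk0 pNb yr -EFin_natmul -EFinD.
  - move=> [k /= kk0] _; rewrite /Q; case: (real_p k) => [->|[bk pk]].
      by rewrite yr -EFin_natmul addye // leey.
    rewrite pk yr -EFin_natmul -!EFinD lee_fin.
    have := leN k bk (ltnW (leq_trans kk0 k0N)) pk.
    rewrite -?(mulr_natr a) -!(mulr_natr r) natrB ?(ltnW k0N) // => h.
    by apply: newton_lower h ra _; rewrite ler_nat.
  rewrite addeCA -yr => <-; rewrite yr -EFinD.
  have -> : r *+ (N - k0) + (b + r *+ k0) = b + r *+ N.
    by rewrite addrCA -mulrnDr subnK // ltnW.
  apply: (@bigmin_attained _ _ _ _ _ ord_max) => //=.
    by rewrite pNb -EFin_natmul -EFinD.
  move=> [k /= kN] _; case: (real_p k) => [->|[bk pk]].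
    by rewrite -EFin_natmul addye // leey.
  rewrite pk -EFin_natmul -EFinD lee_fin.
  have := leN k bk kN pk.
  rewrite -?(mulr_natr a) -!(mulr_natr r) => h.
  have := @newton_lower _ a r b bk k%:R N%:R N%:R h ra.
  by rewrite subrr mulr0 subr0 ler_nat; apply.
have min_r : mine y a%:E = a%:E by apply/min_idPr; exact: ltW.
have -> : s = (a *+ (N - k0))%:E by rewrite sE min_r EFin_natmul.
rewrite addeCA -cE //.
have [k _ kmin] := @eq_bigmin _ _ 'I_k0.+1 +oo%E ord_max xpredT
  (fun k => Q k + y *+ k)%E isT (fun k _ => leey _).
have term (j : nat) : ((a *+ (N - k0))%:E + (Q j + y *+ j) = p j + y *+ j)%E.
  by rewrite addeA /Q addeCA -EFinD subrr adde0.
rewrite kmin term.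
have kN : (k < N.+1)%N by rewrite (leq_trans (ltn_ord k)) // ltnS ltnW.
apply: (@bigmin_attained _ _ _ _ _ (Ordinal kN)) => //= -[j jN] _ /=.
have mle (i : 'I_k0.+1) : (p k + y *+ k <= p i + y *+ i)%E.
  by rewrite -!term leeD2lE // -kmin; apply: bigmin_le.
have [jk0|k0j] := leqP j k0; first exact: (mle (@Ordinal k0.+1 j jk0)).
apply: le_trans (mle ord_max) _ => /=.
case: (real_p j) => [->|[bj pj]]; first by rewrite addye ?leey // ereal_mulrn_neqNy.
case: y yN ay {cE sE s min_r kmin mle term} => [r| |] // _ ay; last first.
  by rewrite -(prednK (leq_ltn_trans (leq0n k0) k0j)) enatmul_pinfty addey ?leey // pj.
rewrite pk0 pj -!EFin_natmul -!EFinD lee_fin.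
have := leN j bj jN pj; rewrite bE' -?(mulr_natr a) -!(mulr_natr r).
rewrite lte_fin in ay => h.
by apply: newton_upper h (ltW ay) _; rewrite ler_nat ltnW.
Qed.

Lemma mp_deg_max (R : realType) (P : seq (\bar R)) k :
  nth +oo%E P k != +oo%E -> (k <= mp_deg P)%N.
Proof.
move=> Pk; have kP : (k < size P)%N.
  by rewrite ltnNge; apply: contra Pk => /(nth_default +oo%E)->.
exact: (@leq_bigmax_cond _ _ (fun i : 'I_(size P) => nat_of_ord i) (Ordinal kP)).
Qed.

Lemma mp_deg_finite (R : realType) (P : seq (\bar R)) k :
  nth +oo%E P k != +oo%E -> nth +oo%E P (mp_deg P) != +oo%E.
Proof.
move=> Pk; have kP : (k < size P)%N.
  by rewrite ltnNge; apply: contra Pk => /(nth_default +oo%E)->.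
have C : (0 < #|[pred i : 'I_(size P) | nth +oo%E P i != +oo%E]|)%N.
  by apply/card_gt0P; exists (Ordinal kP).
by rewrite /mp_deg; case: (eq_bigmax_cond (fun i : 'I_(size P) => nat_of_ord i) C) => i + ->.
Qed.

(** As [mp_roots] is chosen by [xget], exhibiting one factorization is enough; sorting supplies the
    order. *)
Lemma mp_factorization_mp_roots (R : realType) (P : seq (\bar R)) k :
  (forall k, nth +oo%E P k != -oo%E) -> nth +oo%E P k != +oo%E ->
  mp_factorization P (mp_roots P).
Proof.
move=> PNy Pk; have PN := mp_deg_finite Pk.
suff H : exists c, mp_factorization P c by exact: (xgetPex [::] H).
have [c [sc cN cE]] := mp_newton_factorization PNy PN.
exists (sort <=%O c); split.
- by rewrite size_sort.
- exact: sort_le_sorted.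
- by rewrite mem_sort.
move=> y yN; rewrite (perm_big c) /= ?perm_sort // -cE //.
have sP : ((mp_deg P).+1 <= size P)%N.
  by rewrite ltnNge; apply: contra PN => /(nth_default +oo%E)->.
have [j _ jmin] := @eq_bigmin _ _ 'I_(mp_deg P).+1 +oo%E ord_max xpredT
  (fun k => nth +oo%E P k + y *+ k)%E isT (fun k _ => leey _).
rewrite jmin.
(* Coefficients past the degree are [+oo] and do not affect the minimum. *)
apply: (@bigmin_attained _ _ _ _ _ (widen_ord sP j)) => // i _.
have [Pi|Pi] := eqVneq (nth +oo%E P i) +oo%E.
  by rewrite Pi addye ?leey // ereal_mulrn_neqNy.
have iN : (i < (mp_deg P).+1)%N by rewrite ltnS mp_deg_max.
rewrite -jmin; exact: (@bigmin_le _ _ _ _ (Ordinal iN)).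
Qed.

(** * One-sided slopes and the extreme active exponents *)

Lemma exists_small (R : realType) (s : seq R) :
  exists2 d : R, 0 < d & forall x, x \in s -> 0 < x -> d < x.
Proof.
elim: s => [|x s [d d0 H]]; first by exists 1.
have [x0|x0] := ltP 0 x; last first.
  by exists d => // z; rewrite in_cons => /predU1P[->|/H//]; rewrite ltNge x0.
exists (Num.min d (x / 2)); first by rewrite lt_min d0 divr_gt0.
move=> z; rewrite in_cons => /predU1P[-> _|/H{}H /H {}H]; rewrite gt_min.
  by rewrite ltr_pdivrMr // ltr_pMr // ltr1n orbT.
by rewrite H.
Qed.

Lemma sum_mine_fin (R : realType) (c : seq (\bar R)) (r : R) :
  -oo%E \notin c -> exists S : R, (\sum_(x <- c) mine r%:E x)%E = S%:E.
Proof.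
elim: c => [|x c IH]; first by exists 0; rewrite big_nil.
rewrite in_cons negb_or => /andP[xN /IH[S SE]]; rewrite big_cons SE.
case: x xN => [a| |] // _; last by exists (r + S); rewrite miney.
by exists (Num.min r a + S); rewrite -EFin_min.
Qed.

(** The function [min(_, x)] has right slope 1 at [g] exactly when [g < x], and it stays linear up
    to [g + e] since no root lies strictly in between. *)
Lemma sum_mine_above (R : realType) (c : seq (\bar R)) (g e : R) :
  0 <= e -> -oo%E \notin c ->
  (forall r : R, r%:E \in c -> g < r -> g + e <= r) ->
  (\sum_(x <- c) mine (g + e)%:E x =
     \sum_(x <- c) mine g%:E x + (e *+ count (fun x => (g%:E < x)%E) c)%:E)%E.
Proof.
move=> e0; elim: c => [|x c IH] cN H; first by rewrite !big_nil mulr0n adde0.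
move: cN; rewrite in_cons negb_or => /andP[xN cN].
rewrite !big_cons /= IH //; last by move=> r rc; apply: H; rewrite in_cons rc orbT.
have [S ->] := sum_mine_fin g cN.
have -> : mine (g + e)%:E x = (mine g%:E x + (e *+ (g%:E < x)%E)%:E)%E.
  case: x xN H {IH} => [a| |] // _ H.
    rewrite lte_fin; have [ga|ag] := ltP g a.
      have {}H := H a (mem_head _ _) ga.
      by rewrite !min_l ?lee_fin // ltW.
    by rewrite !min_r ?lee_fin ?adde0 // (le_trans ag) // lerDl.
  by rewrite !miney ltry.
have [m ->] : exists m, mine g%:E x = m%:E.
  case: x {H IH} xN => [a| |] // _; last by exists g; rewrite miney.
  by exists (Num.min g a); rewrite EFin_min.
by rewrite -!EFinD; congr EFin; rewrite mulrnDr; ring.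
Qed.

(** Left slopes also count the roots equal to [g]; this is the difference between [lo] and [hi] in
    [mp_active_range]. *)
Lemma sum_mine_below (R : realType) (c : seq (\bar R)) (g e : R) :
  0 <= e -> -oo%E \notin c ->
  (forall r : R, r%:E \in c -> r < g -> r <= g - e) ->
  (\sum_(x <- c) mine (g - e)%:E x =
     \sum_(x <- c) mine g%:E x - (e *+ count (fun x => (g%:E <= x)%E) c)%:E)%E.
Proof.
move=> e0; elim: c => [|x c IH] cN H; first by rewrite !big_nil mulr0n sube0.
move: cN; rewrite in_cons negb_or => /andP[xN cN].
rewrite !big_cons /= IH //; last by move=> r rc; apply: H; rewrite in_cons rc orbT.
have [S ->] := sum_mine_fin g cN.
have -> : mine (g - e)%:E x = (mine g%:E x - (e *+ (g%:E <= x)%E)%:E)%E.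
  case: x xN H {IH} => [a| |] // _ H; last by rewrite !miney leey.
  rewrite lee_fin; have [ga|ag] := leP g a.
    by rewrite !min_l ?lee_fin // (le_trans _ ga) // gerBl.
  have {}H := H a (mem_head _ _) ag.
  by rewrite !min_r ?lee_fin ?(ltW ag) // mulr0n sube0.
have [m ->] : exists m, mine g%:E x = m%:E.
  case: x {H IH} xN => [a| |] // _; last by exists g; rewrite miney.
  by exists (Num.min g a); rewrite EFin_min.
by rewrite -?EFinN -!EFinD; congr EFin; rewrite mulrnDr; ring.
Qed.

Lemma mp_eval_le (R : realType) (P : seq (\bar R)) k (r bk : R) :
  nth +oo%E P k = bk%:E -> (mp_eval P r%:E <= (bk + r *+ k)%:E)%E.
Proof.
move=> Pk; have kP : (k < size P)%N.
  by rewrite ltnNge; apply/negP => /(nth_default +oo%E); rewrite Pk.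
rewrite EFinD EFin_natmul -Pk.
exact: (@bigmin_le _ _ _ _ (Ordinal kP)).
Qed.

(* The counts are the one-sided slopes at [g] of the concave function
   [mp_eval P], hence the extreme exponents attaining the minimum at [g]. *)
Lemma mp_active_range (R : realType) (P c : seq (\bar R)) (g : R) :
  (forall k, nth +oo%E P k != -oo%E) -> nth +oo%E P (mp_deg P) != +oo%E ->
  mp_factorization P c ->
  let lo := count (fun x => (g%:E < x)%E) c in
  let hi := count (fun x => (g%:E <= x)%E) c in
  exists v : R, [/\ mp_eval P g%:E = v%:E,
    forall k, (nth +oo%E P k + (g *+ k)%:E = v%:E)%E -> (lo <= k <= hi)%N,
    (nth +oo%E P lo + (g *+ lo)%:E = v%:E)%E &
    (nth +oo%E P hi + (g *+ hi)%:E = v%:E)%E].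
Proof.
move=> PNy PN [sc _ cNy cE] lo hi.
have real_P k : nth +oo%E P k = +oo%E \/ exists b, nth +oo%E P k = b%:E.
  by case: (nth _ P k) (PNy k) => [b| |] // _; [right; exists b | left].
have [b pNb] : exists b, nth +oo%E P (mp_deg P) = b%:E.
  by case: (real_P (mp_deg P)) PN => // ->.
have [S SE] := sum_mine_fin g cNy.
pose v := b + S; pose M := (mp_deg P).+1.
have evg : mp_eval P g%:E = v%:E by rewrite cE // pNb SE.
pose gap k := fine (nth +oo%E P k) + g *+ k - v.
(* [e] is below the distance from [g] to the other finite roots, and [e *+ M] is below the gap of
   every inactive term; moving the slope by [e] cannot make such a term minimal. *)
have [e e0 eP] := exists_small ([seq `|fine x - g| | x <- c] ++
  [seq gap k / M%:R | k <- iota 0 M]).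
have M0 : 0 < M%:R :> R by rewrite ltr0n.
have ec (r : R) : r%:E \in c -> r != g -> e < `|r - g|.
  move=> rc rg; apply: eP; last by rewrite normr_gt0 subr_eq0.
  by rewrite mem_cat (map_f (fun x => `|fine x - g|) rc).
have egap k : nth +oo%E P k != +oo%E -> 0 < gap k -> e *+ M < gap k.
  move=> Pk gk; rewrite -mulr_natr -ltr_pdivlMr //; apply: eP; last exact: divr_gt0.
  rewrite mem_cat (map_f (fun k => gap k / M%:R)) ?orbT // mem_iota /=.
  by rewrite ltnS mp_deg_max.
have evr : mp_eval P (g + e)%:E = (v + e *+ lo)%:E.
  rewrite cE // (sum_mine_above (ltW e0)) // ?SE ?pNb -?EFinD ?addrA //.
  move=> r rc gr; have := ec r rc (negbT (gt_eqF gr)).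
  by rewrite gtr0_norm ?subr_gt0 // ltrBrDl => /ltW.
have evl : mp_eval P (g - e)%:E = (v - e *+ hi)%:E.
  rewrite cE // (sum_mine_below (ltW e0)) // ?SE ?pNb -?EFinN -?EFinD ?addrA //.
  move=> r rc gr; have := ec r rc (negbT (lt_eqF gr)).
  by rewrite ltr0_norm ?subr_lt0 // opprB ltrBrDl addrC -ltrBrDl => /ltW.
have evle := @mp_eval_le _ P.
have evat r : exists k bk, nth +oo%E P k = bk%:E /\ (bk + r *+ k)%:E = mp_eval P r%:E.
  have sP : (mp_deg P < size P)%N.
    by rewrite ltnNge; apply: contra PN => /(nth_default +oo%E)->.
  rewrite /mp_eval.
  have [j _ jmin] := @eq_bigmin _ _ 'I_(size P) +oo%E (Ordinal sP) xpredT
    (fun k => nth +oo%E P k + r%:E *+ k)%E isT (fun k _ => leey _).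
  rewrite jmin; case: (real_P j) => [Pj|[bj Pj]].
    have := evle (mp_deg P) r b pNb.
    by rewrite /mp_eval jmin Pj -EFin_natmul addye // leye_eq.
  by exists j, bj; rewrite Pj -EFin_natmul.
have gap0 k bk m : nth +oo%E P k = bk%:E -> (m < M)%N -> gap k <= e *+ m -> gap k = 0.
  move=> Pk mM gm; apply/eqP; rewrite eq_le; apply/andP; split; last first.
    have := evle k g bk Pk; rewrite evg lee_fin /gap Pk subr_ge0; exact.
  rewrite leNgt; apply/negP => /(egap k); rewrite Pk => /(_ isT).
  by rewrite ltNge (le_trans gm) // ler_pMn2l // ltnW.
have loN : (lo < M)%N by rewrite ltnS -sc count_size.
exists v; split=> //.
(* Comparing an active term with the minimum at [g + e] gives [lo <= k], and at [g - e] it gives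
   [k <= hi]. *)
- move=> k; case: (real_P k) => [-> //|[bk Pk]]; rewrite Pk -EFinD => -[bkE].
  have := evle k (g + e) bk Pk; rewrite evr lee_fin.
  have := evle k (g - e) bk Pk; rewrite evl lee_fin.
  have -> : bk = v - g *+ k by rewrite -bkE addrK.
  rewrite mulrnBl mulrnDl [X in _ <= X -> _]addrA subrK lerD2l lerN2 ler_pMn2l //.
  by rewrite [X in _ <= X -> _]addrA subrK lerD2l ler_pMn2l // => -> ->.
(* The minimal term at [g + e] has gap at most [e *+ lo], too small to be positive: it is active at
   [g], and its exponent is [lo]. *)
- have [k [bk [Pk]]] := evat (g + e); rewrite evr => -[bkE].
  have gapE : gap k + e *+ k = e *+ lo.
    by apply: (addrI v); rewrite -bkE /gap Pk /= mulrnDl; ring.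
  have g0 : gap k = 0.
    by apply: (gap0 k bk lo) => //; rewrite -gapE lerDl mulrn_wge0 // ltW.
  have kE : k = lo.
    by apply: (@mulrIn _ e); rewrite ?gt_eqF // -gapE g0 add0r.
  by rewrite -kE Pk -EFinD; congr EFin; apply/eqP; rewrite -subr_eq0 -g0 /gap Pk.
- have [k [bk [Pk]]] := evat (g - e); rewrite evl => -[bkE].
  have gapE : gap k + e *+ hi = e *+ k.
    apply: (addrI (v - e *+ hi)); rewrite -[in RHS]bkE /gap Pk /= mulrnBl; ring.
  have kM : (k < M)%N by rewrite ltnS mp_deg_max // Pk.
  have g0 : gap k = 0.
    by apply: (gap0 k bk k) => //; rewrite -gapE lerDl mulrn_wge0 // ltW.
  have kE : k = hi.
    by apply: (@mulrIn _ e); rewrite ?gt_eqF // -gapE g0 add0r.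
  by rewrite -kE Pk -EFinD; congr EFin; apply/eqP; rewrite -subr_eq0 -g0 /gap Pk.
Qed.

(** Beyond all finite roots only the infinite ones are counted, so one exponent [z] is minimal for
    every large slope; a smaller exponent with a finite coefficient would eventually win. *)
Lemma mp_large_slope (R : realType) (P c : seq (\bar R)) :
  (forall k, nth +oo%E P k != -oo%E) -> nth +oo%E P (mp_deg P) != +oo%E ->
  mp_factorization P c ->
  mp_val P = count_mem +oo%E c /\
  exists g : R, count (fun x => (g%:E < x)%E) c = count_mem +oo%E c.
Proof.
move=> PNy PN fc.
have cN : -oo%E \notin c by case: fc.
have [g gP] : exists g : R, forall g', g <= g' ->
    count (fun x => (g'%:E < x)%E) c = count_mem +oo%E c.
  elim: (c) cN => [|x s IH]; first by exists 0.
  rewrite in_cons negb_or => /andP[xN /IH[g gP]].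
  exists (Num.max g (fine x)) => g'; rewrite ge_max => /andP[gg xg] /=.
  rewrite gP //; congr (_ + _)%N; case: x xN xg => [a| |] //= _ xg.
    by rewrite lte_fin ltNge xg.
  by rewrite ltry.
split; last by exists g; apply: gP.
set z := count_mem _ _ in gP *.
have real_P k : nth +oo%E P k = +oo%E \/ exists b, nth +oo%E P k = b%:E.
  by case: (nth _ P k) (PNy k) => [b| |] // _; [right; exists b | left].
have Pz g' : g <= g' -> exists v : R, mp_eval P g'%:E = v%:E /\
    (nth +oo%E P z + (g' *+ z)%:E = v%:E)%E.
  move=> /gP gz; have [v] := mp_active_range g' PNy PN fc; rewrite gz => -[e1 _ e2 _].
  by exists v.
have [v0 [_]] := Pz g (lexx _); case: (real_P z) => [->//|[bz Pzb] _].
have hasP : has (fun c => c != +oo%E) P.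
  apply/(has_nthP +oo%E); exists z; last by rewrite Pzb.
  by rewrite ltnNge; apply/negP => /(nth_default +oo%E); rewrite Pzb.
apply/anti_leq/andP; split.
  rewrite /mp_val /valuation leqNgt; apply/negP => /(before_find +oo%E).
  by rewrite Pzb.
rewrite leqNgt; apply/negP => valz.
have := nth_find +oo%E hasP; rewrite -[find _ _]/(mp_val P) => Pval.
case: (real_P (mp_val P)) Pval => [->//|[bv Pv] _].
(* If the valuation were below [z], minimality of [z] at slope [G] would force [G <= bv - bz]. *)
pose G := Num.max g (`|bv - bz| + 1).
have gG : g <= G by rewrite le_max lexx.
have [v [ev]] := Pz G gG; rewrite Pzb -EFinD => -[vE].
have := mp_eval_le G Pv; rewrite ev -vE lee_fin -(subnKC valz) mulrnDr mulrSr.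
have G1 : `|bv - bz| + 1 <= G by rewrite le_max lexx orbT.
have Gm : 0 <= G *+ (z - (mp_val P).+1).
  by rewrite mulrn_wge0 // (le_trans _ G1) // addr_ge0.
have := ler_norm (bv - bz); lra.
Qed.

Lemma mp_small_slope (R : realType) (c : seq (\bar R)) :
  -oo%E \notin c -> exists g : R, count (fun x => (g%:E <= x)%E) c = size c.
Proof.
move=> cN; suff [g gP] : exists g : R, forall g', g' <= g ->
    count (fun x => (g'%:E <= x)%E) c = size c by exists g; apply: gP.
elim: c cN => [|x s IH]; first by exists 0.
rewrite in_cons negb_or => /andP[xN /IH[g gP]].
exists (Num.min g (fine x)) => g'; rewrite le_min => /andP[gg xg] /=.
rewrite gP // -add1n; congr (_ + _)%N; case: x xN xg => [a| |] //= _ xg.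
  by rewrite lee_fin xg.
by rewrite leey.
Qed.

(** * Potentials and Hungarian pairs *)

Fixpoint walk_weight (T : Type) (R : nmodType) (c : T -> T -> R) (x : T) (p : seq T) : R :=
  if p is y :: q then c x y + walk_weight c y q else 0.

Lemma walk_weight_cat (T : Type) (R : nmodType) (c : T -> T -> R) x p q :
  walk_weight c x (p ++ q) = walk_weight c x p + walk_weight c (last x p) q.
Proof. by elim: p x => [|y p IH] x /=; rewrite ?add0r // IH addrA. Qed.

Lemma walk_weight_fpath (T : eqType) (R : nmodType) (c : T -> T -> R) f x q :
  fpath f x q -> walk_weight c x q = \sum_(i <- belast x q) c i (f i).
Proof.
elim: q x => [|y q IH] x /=; first by rewrite big_nil.
by rewrite big_cons => /andP[/eqP-> /IH->].
Qed.

Lemma not_uniq_split (T : eqType) (s : seq T) :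
  ~~ uniq s -> exists y p1 p2 p3, s = p1 ++ y :: p2 ++ y :: p3.
Proof.
elim: s => // x s IH /=; rewrite negb_and negbK => /orP[/splitPr[p2 p3]|/IH].
  by exists x, [::], p2, p3.
by move=> [y [p1 [p2 [p3 ->]]]]; exists y, (x :: p1), p2, p3.
Qed.

(* A closed walk splits into simple cycles, each of which is a permutation up to
   fixed points. *)
Lemma closed_walk_ge0 (T : finType) (R : numDomainType) (c : T -> T -> R) :
  (forall i, c i i = 0) -> (forall s : {perm T}, 0 <= \sum_i c i (s i)) ->
  forall x p, 0 <= walk_weight c x (rcons p x).
Proof.
move=> c0 cs x p; have [m] := ubnP (size p); elim: m x p => // m IH x p /ltnSE pm.
have [Up|/not_uniq_split[y [p1 [p2 [p3 E]]]]] := boolP (uniq (x :: p)).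
  (* A closed walk without repetition follows the permutation [next], which fixes all other points
     at cost 0. *)
  pose s := perm (can_inj (prev_next Up)).
  have /walk_weight_fpath -> : fpath (next (x :: p)) x (rcons p x) := cycle_next Up.
  rewrite belast_rcons big_uniq //=; have := cs s.
  rewrite (bigID (mem (x :: p))) /= [X in _ <= _ + X]big1 ?addr0 => [|i ip].
    by under eq_bigr do rewrite permE.
  by rewrite permE next_nth (negPf ip) c0.
(* Cutting at a repeated vertex [y] leaves a closed walk at [y] and a shorter closed walk at [x]. *)
have sE : (size p2 < m)%N /\ (size p1 + size p3 < m)%N.
  have := congr1 size E; rewrite /= !size_cat /= size_cat /= => sp.
  by split; move: pm sp; lia.
have c2 : 0 <= walk_weight c y (rcons p2 y) by apply: IH; case: sE.
case: p1 E sE => [[-> ->]|x' p1 [<- ->]] /= [s2 s3].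
  rewrite -cats1 -catA /= -cat_rcons walk_weight_cat last_rcons cats1.
  by rewrite addr_ge0 // IH.
have -> : rcons (p1 ++ y :: p2 ++ y :: p3) x = rcons p1 y ++ (rcons p2 y ++ rcons p3 x).
  by rewrite -!cats1 -!catA /= -!catA.
rewrite !walk_weight_cat !last_rcons addrCA addr_ge0 //.
rewrite -{2}[y](last_rcons x p1 y) -walk_weight_cat -rcons_cat IH //.
by rewrite size_cat size_rcons; move: s3; lia.
Qed.

(** Shortest-path potential: [D i] is the infimum of the weights of the walks from [i], bounded
    below because the walk closed by an arc back to [i] has nonnegative weight. *)
Lemma exists_potential (T : finType) (R : realType) (c : T -> T -> R) :
  (forall i, c i i = 0) -> (forall s : {perm T}, 0 <= \sum_i c i (s i)) ->
  exists D : T -> R, forall i j, D i <= c i j + D j.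
Proof.
move=> c0 cs.
pose W i := [set walk_weight c i p | p in [set: seq T]].
have Wne i : W i !=set0 by exists 0, [::].
have Wlb i : has_inf (W i).
  split; first exact: Wne.
  exists (- \sum_j `|c j i|) => _ [p _ <-].
  have := closed_walk_ge0 c0 cs i p; rewrite -cats1 walk_weight_cat /= addr0 => h.
  have : c (last i p) i <= \sum_j `|c j i|.
    by rewrite (bigD1 (last i p)) //= (le_trans (ler_norm _)) // lerDl sumr_ge0.
  lra.
exists (fun i => inf (W i)) => i j; rewrite -lerBlDl.
apply: lb_le_inf => // _ [p _ <-]; rewrite lerBlDl.
by apply: ge_inf; [case: (Wlb i) | exists (j :: p)].
Qed.

Lemma sum_tight (R : realType) (I : finType) (f : I -> \bar R) (g : I -> R) :
  (forall i, ((g i)%:E <= f i)%E) -> (\sum_i f i)%E = (\sum_i g i)%:E ->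
  forall i, f i = (g i)%:E.
Proof.
move=> gf fg i.
have ffin j : f j \is a fin_num.
  have /sum_fin_numP : (\sum_j f j)%E \is a fin_num by rewrite fg.
  by apply; rewrite ?mem_index_enum.
rewrite -(fineK (ffin i)); congr EFin.
have : \sum_j (fine (f j) - g j) = 0.
  apply/eqP; rewrite sumrB subr_eq0; apply/eqP/EFin_inj.
  by rewrite EFin_sum_fine ?fg.
move/psumr_eq0P => H; apply/eqP; rewrite -subr_eq0; apply/eqP; apply: H => // j _.
by rewrite subr_ge0 -lee_fin fineK.
Qed.

Lemma sum_hungarian (R : nmodType) n (U V : 'I_n -> R) (s : 'S_n) :
  \sum_i (U i + V (s i)) = \sum_i U i + \sum_j V j.
Proof. by rewrite big_split /=; congr (_ + _); rewrite [RHS](reindex_inj (@perm_inj _ s)). Qed.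

(** The values [U i + V (s i)] have the same sum [mp_per B] for every [s], so optimality amounts to
    tightness on every arc. *)
Lemma Sat_perm (R : realType) n (B : 'M[\bar R]_n) U V (s : 'S_n) :
  hungarian_pair B U V ->
  (forall i, Sat B U V i (s i)) <-> mp_weight B s = mp_per B.
Proof.
move=> [BUV <-]; rewrite -(sum_hungarian _ _ s); split=> [H|H i].
  by rewrite -sumEFin; apply: eq_bigr => i _; apply/eqP/H.
by apply/eqP; apply: (sum_tight (f := fun i => B i (s i)) (g := fun i => U i + V (s i))).
Qed.

(** Duality for the assignment problem: relative to an optimal [s0], permuting the columns has
    nonnegative cost, so a potential exists and serves as [U]. *)
Lemma exists_hungarian_pair (R : realType) n (B : 'M[\bar R]_n) (b : R) :
  (forall i j, B i j != -oo%E) -> mp_per B = b%:E ->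
  exists U V, hungarian_pair B U V.
Proof.
move=> BNy Bb.
have real_B i j : B i j = +oo%E \/ exists x, B i j = x%:E.
  by case: (B i j) (BNy i j) => [x| |] // _; [right; exists x | left].
have [s0 _ s0E] := @eq_bigmin _ _ 'S_n +oo%E 1%g xpredT (mp_weight B) isT (fun k _ => leey _).
rewrite -[LHS]/(mp_per B) Bb in s0E.
have s0fin i : B i (s0 i) \is a fin_num.
  have /sum_fin_numP : mp_weight B s0 \is a fin_num by rewrite -s0E.
  by apply; rewrite ?mem_index_enum.
pose N i := \sum_j `|fine (B i j)|; pose S := \sum_i N i.
have N0 i : 0 <= N i by rewrite sumr_ge0.
have BN i j : `|fine (B i j)| <= N i by rewrite /N (bigD1 j) //= lerDl sumr_ge0.
have S0 : 0 <= S by rewrite sumr_ge0.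
(* One entry [S + S] outweighs all the others, whose sum is at least [- S]; the total is then at
   least [S >= b], and [s0] remains optimal once [+oo] is replaced. *)
pose Br i j : R := if B i j == +oo%E then S + S else fine (B i j).
have BrE i j : B i j \is a fin_num -> B i j = (Br i j)%:E.
  by rewrite /Br; case: (B i j).
have BrN i j : - N i <= Br i j.
  rewrite /Br; case: ifP => _.
    by rewrite (le_trans _ (addr_ge0 S0 S0)) // oppr_le0.
  by rewrite lerNl (le_trans _ (BN i j)) // -normrN ler_norm.
have bE : b = \sum_i Br i (s0 i).
  apply: EFin_inj; rewrite s0E -sumEFin; apply: eq_bigr => i _; exact: BrE.
have opt (s : 'S_n) : b <= \sum_i Br i (s i).
  have [fs|/existsP[i0]] := boolP [forall i, B i (s i) \is a fin_num].
    rewrite -lee_fin -Bb -sumEFin.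
    have -> : (\sum_i (Br i (s i))%:E = mp_weight B s)%E.
      by apply: eq_bigr => i _; rewrite -BrE //; exact: (forallP fs).
    exact: bigmin_le.
  move: (real_B i0 (s i0)) => [Bi _|[x ->]//].
  have : b <= S.
    rewrite bE; apply: ler_sum => i _; rewrite (le_trans _ (BN i (s0 i))) //.
    rewrite -[Br i _]/(fine (Br i (s0 i))%:E) -BrE // ler_norm //.
  have : S + S - S <= \sum_i Br i (s i).
    rewrite [leRHS](bigD1 i0) //= {1}/Br Bi eqxx lerD //.
    apply: (@le_trans _ _ (\sum_(i | i != i0) - N i)); last first.
      by apply: ler_sum => i _; apply: BrN.
    by rewrite sumrN lerN2 /S [leRHS](bigD1 i0) //= lerDr.
  lra.
(* The extra cost when row [i] takes over the column of row [j]. *)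
pose c i j := Br i (s0 j) - Br j (s0 j).
have c0 i : c i i = 0 by rewrite /c subrr.
have cs (s : 'S_n) : 0 <= \sum_i c i (s i).
  have e : \sum_i Br (s i) (s0 (s i)) = b by rewrite bE [RHS](reindex_inj (@perm_inj _ s)).
  rewrite sumrB subr_ge0 e (le_trans (opt (s * s0)%g)) //; apply: ler_sum => i _.
  by rewrite permM.
have [D DP] := exists_potential c0 cs.
(* [V] is dictated by tightness on the arcs of [s0]. *)
exists D, (fun k => Br (s0^-1%g k) k - D (s0^-1%g k)); split.
  move=> i k; have := DP i (s0^-1%g k); rewrite /c permKV => h.
  apply: (@le_trans _ _ (Br i k)%:E); first by rewrite lee_fin; lra.
  by case: (real_B i k) => [->|[x Bx]]; rewrite ?leey // -BrE // Bx.
rewrite Bb bE -(sum_hungarian _ _ s0); congr EFin; apply: eq_bigr => i _.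
by rewrite permK addrC subrK.
Qed.

(** A permutation pieced together from arcs of several optimal permutations is optimal, all these
    arcs being saturated by one Hungarian pair. *)
Lemma Opt_perm (R : realType) n (B : 'M[\bar R]_n) (b : R) (s : 'S_n) :
  (forall i j, B i j != -oo%E) -> mp_per B = b%:E ->
  (forall i, Opt B i (s i)) <-> mp_weight B s = mp_per B.
Proof.
move=> BNy Bb; have [U [V UV]] := exists_hungarian_pair BNy Bb; split=> H; last first.
  by move=> i; apply/existsP; exists s; rewrite eqxx H eqxx.
apply/(Sat_perm s UV) => i; have /existsP[t /andP[/eqP-> /eqP wt]] := H i.
by move/(Sat_perm t UV): wt.
Qed.

(** * The active monomials at a given slope *)

Lemma mp_charcoef_le (R : realType) n d (A : 'I_d.+1 -> 'M[\bar R]_n)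
    (s : 'S_n) (k : {ffun 'I_n -> 'I_d.+1}) :
  (mp_charcoef A (\sum_(i < n) k i) <= \sum_(i < n) A (k i) i (s i))%E.
Proof. by apply: le_trans (bigmin_le _ s _) _; apply: bigmin_le_cond. Qed.

Lemma mp_charcoef_attained (R : realType) n d (A : 'I_d.+1 -> 'M[\bar R]_n) l :
  mp_charcoef A l != +oo%E -> exists (s : 'S_n) (k : {ffun 'I_n -> 'I_d.+1}),
    (\sum_(i < n) k i)%N = l /\ mp_charcoef A l = (\sum_(i < n) A (k i) i (s i))%E.
Proof.
rewrite {1}/mp_charcoef => H.
have [s _ sE] := @eq_bigmin _ _ 'S_n +oo%E 1%g xpredT (fun s =>
    \big[mine/+oo%E]_(k : {ffun 'I_n -> 'I_d.+1} | (\sum_(i < n) k i)%N == l)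
      (\sum_(i < n) A (k i) i (s i))%E) isT (fun k _ => leey _).
rewrite sE in H.
have [k0 k0l] : exists k : {ffun 'I_n -> 'I_d.+1}, (\sum_(i < n) k i)%N == l.
  apply/existsP; apply: contraT; rewrite negb_exists => /forallP k0.
  by move: H; rewrite big_pred0 ?eqxx // => k; apply/negbTE.
have [k kl kE] := @eq_bigmin _ _ _ +oo%E k0
  (fun k : {ffun 'I_n -> 'I_d.+1} => (\sum_(i < n) k i)%N == l) (fun k =>
      (\sum_(i < n) A (k i) i (s i))%E) k0l (fun k _ => leey _).
by exists s, k; split; [exact/eqP | rewrite /mp_charcoef sE kE].
Qed.

Lemma nth_mp_charpoly (R : realType) n d (A : 'I_d.+1 -> 'M[\bar R]_n) l :
  nth +oo%E (mp_charpoly A) l = mp_charcoef A l.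
Proof.
have [ll|ll] := ltnP l (n * d).+1; first by rewrite nth_mkseq.
rewrite nth_default ?size_mkseq //; apply/esym/eqP; apply: contraT.
move=> /mp_charcoef_attained[s [k [kl _]]].
by move: ll; rewrite -kl ltnNge sum_expo_le.
Qed.

Lemma sum_neqNy (R : realType) (I : finType) (f : I -> \bar R) :
  (forall i, f i != -oo%E) -> (\sum_i f i)%E != -oo%E.
Proof.
move=> fN; rewrite esum_eqNy negb_exists; apply/forallP => i.
by rewrite negb_and fN orbT.
Qed.

Lemma mp_charcoef_neqNy (R : realType) n d (A : 'I_d.+1 -> 'M[\bar R]_n) l :
  (forall k i j, A k i j != -oo%E) -> mp_charcoef A l != -oo%E.
Proof.
move=> ANy; have [->//|/mp_charcoef_attained[s [k [_ ->]]]] := eqVneq (mp_charcoef A l) +oo%E.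
exact: sum_neqNy.
Qed.

Lemma sum_shift (R : realType) n d (A : 'I_d.+1 -> 'M[\bar R]_n) (g : R)
    (s : 'S_n) (k : {ffun 'I_n -> 'I_d.+1}) :
  (\sum_(i < n) (A (k i) i (s i) + (g *+ k i)%:E) =
   \sum_(i < n) A (k i) i (s i) + (g *+ \sum_(i < n) k i)%:E)%E.
Proof. by rewrite big_split /= sumEFin -sumrMnr. Qed.

Lemma mp_hat_le (R : realType) n d (A : 'I_d.+1 -> 'M[\bar R]_n) g k i j :
  (mp_hat A g i j <= A k i j + (g *+ k)%:E)%E.
Proof. by rewrite mxE; apply: bigmin_le. Qed.

Lemma mp_hat_attained (R : realType) n d (A : 'I_d.+1 -> 'M[\bar R]_n) g i j :
  exists k, mp_hat A g i j = (A k i j + (g *+ k)%:E)%E.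
Proof.
have [k _ kE] := @eq_bigmin _ _ _ +oo%E ord0 xpredT
  (fun k : 'I_d.+1 => A k i j + (g *+ k)%:E)%E isT (fun k _ => leey _).
by exists k; rewrite mxE kE.
Qed.

Lemma mp_hat_neqNy (R : realType) n d (A : 'I_d.+1 -> 'M[\bar R]_n) g i j :
  (forall k i j, A k i j != -oo%E) -> mp_hat A g i j != -oo%E.
Proof.
move=> ANy; have [k ->] := mp_hat_attained A g i j.
by case: (A k i j) (ANy k i j).
Qed.

Definition active_entries (R : realType) n d (A : 'I_d.+1 -> 'M[\bar R]_n)
    (g : R) (G : rel 'I_n) : {set 'I_d.+1 * 'I_n * 'I_n} :=
  [set x | graph_cap (graph_level A g x.1.1) G x.1.2 x.2].

Lemma a_gammaE (R : realType) n d (A : 'I_d.+1 -> 'M[\bar R]_n) g G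
    (y : 'I_d.+1 * 'I_n * 'I_n -> R[i]) :
  a_gamma A (fun k => \matrix_(i, j) y (k, i, j)) g G =
  coef_on (active_entries A g G) y.
Proof.
by apply/funext => k; apply/matrixP => i j; rewrite !mxE inE.
Qed.

Definition opt_or_sat (R : realType) n (B : 'M[\bar R]_n) (G : rel 'I_n) : Prop :=
  G = Opt B \/ exists U V, hungarian_pair B U V /\ G = Sat B U V.

Lemma mp_eval_le_weight (R : realType) n d (A : 'I_d.+1 -> 'M[\bar R]_n) (g v : R)
    (s : 'S_n) (k : {ffun 'I_n -> 'I_d.+1}) :
  (forall k i j, A k i j != -oo%E) -> mp_eval (mp_charpoly A) g%:E = v%:E ->
  (v%:E <= \sum_(i < n) A (k i) i (s i) + (g *+ \sum_(i < n) k i)%:E)%E.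
Proof.
move=> ANy vE; case wE : (\sum_(i < n) A (k i) i (s i))%E (sum_neqNy (fun i => ANy (k i) i (s i))) => [w| |] // _;
  last by rewrite leey.
have := mp_charcoef_le A s k; rewrite wE -nth_mp_charpoly.
case cE : (nth _ _ _) => [b| |] //; last first.
  by have := mp_charcoef_neqNy (\sum_i k i) ANy; rewrite -nth_mp_charpoly cE.
rewrite -vE => bw; apply: le_trans (mp_eval_le g cE) _.
by rewrite -EFinD lee_fin lerD2r -lee_fin.
Qed.

(** The degrees can be minimized row by row, so the permanent of [mp_hat A g] is the value of the
    min-plus characteristic polynomial at [g]. *)
Lemma mp_per_mp_hat (R : realType) n d (A : 'I_d.+1 -> 'M[\bar R]_n) (g v : R) l :
  (forall k i j, A k i j != -oo%E) -> mp_eval (mp_charpoly A) g%:E = v%:E ->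
  (nth +oo%E (mp_charpoly A) l + (g *+ l)%:E = v%:E)%E ->
  mp_per (mp_hat A g) = v%:E.
Proof.
move=> ANy vE lv.
have le (s : 'S_n) : (v%:E <= mp_weight (mp_hat A g) s)%E.
  have /choice[k kE] := fun i => mp_hat_attained A g i (s i).
  have -> : mp_weight (mp_hat A g) s =
      (\sum_(i < n) (A ([ffun i => k i] i) i (s i) + (g *+ [ffun i => k i] i)%:E))%E.
    by apply: eq_bigr => i _; rewrite kE ffunE.
  by rewrite sum_shift; exact: mp_eval_le_weight.
have [s [k [kl cE]]] : exists (s : 'S_n) (k : {ffun 'I_n -> 'I_d.+1}),
    (\sum_(i < n) k i)%N = l /\ mp_charcoef A l = (\sum_(i < n) A (k i) i (s i))%E.
  by apply: mp_charcoef_attained; apply: contra_eq_neq lv => e; rewrite nth_mp_charpoly e.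
apply: (@bigmin_attained _ _ _ _ _ s) => //.
apply/le_anti; rewrite le andbT -lv nth_mp_charpoly cE -kl -sum_shift.
by apply: lee_sum => i _; apply: mp_hat_le.
Qed.

(** The shifted weight of [(s, k)] dominates the weight of [s] in [mp_hat A g], which dominates the
    permanent [v]. Equality throughout means that [s] is optimal and that each [k i] attains the
    minimum in its entry. *)
Lemma monomial_active (R : realType) n d (A : 'I_d.+1 -> 'M[\bar R]_n) (g v : R) l G
    (s : 'S_n) (k : {ffun 'I_n -> 'I_d.+1}) :
  (forall k i j, A k i j != -oo%E) -> mp_eval (mp_charpoly A) g%:E = v%:E ->
  (nth +oo%E (mp_charpoly A) l + (g *+ l)%:E = v%:E)%E ->
  opt_or_sat (mp_hat A g) G ->
  monomial_in (active_entries A g G) s k <->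
  (\sum_(i < n) A (k i) i (s i) + (g *+ \sum_(i < n) k i)%:E = v%:E)%E.
Proof.
move=> ANy vE lv GE; have perE := mp_per_mp_hat ANy vE lv.
(* For both choices of [G], the permutations contained in [G] are exactly the optimal ones. *)
have Gperm (t : 'S_n) : (forall i, G i (t i)) <-> mp_weight (mp_hat A g) t = v%:E.
  rewrite -perE; case: GE => [->|[U [V [UV ->]]]]; last exact: Sat_perm.
  by apply: Opt_perm perE => i j; apply: mp_hat_neqNy.
rewrite -sum_shift; split=> [/forallP H|H].
  have H' i : [/\ (A (k i) i (s i) + (g *+ k i)%:E = mp_hat A g i (s i))%E & G i (s i)].
    have := H i; rewrite inE /= => /andP[/andP[/eqP Ai _] Gi]; split=> //.
    by rewrite addeC.
  have /Gperm <- : forall i, G i (s i) by move=> i; case: (H' i).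
  by apply: eq_bigr => i _; case: (H' i).
have ffin i : (A (k i) i (s i) + (g *+ k i)%:E)%E \is a fin_num.
  have /sum_fin_numP : (\sum_(i < n) (A (k i) i (s i) + (g *+ k i)%:E))%E \is a fin_num.
    by rewrite H.
  by apply; rewrite ?mem_index_enum.
have hfin i : mp_hat A g i (s i) \is a fin_num.
  rewrite fin_numE mp_hat_neqNy //=; apply: contraTneq (ffin i) => e.
  by have := mp_hat_le A g (k i) i (s i); rewrite e leye_eq => /eqP->.
have wE : mp_weight (mp_hat A g) s = v%:E.
  apply/le_anti; rewrite -[X in _ && (X <= _)%E]perE bigmin_le andbT -H.
  by apply: lee_sum => i _; apply: mp_hat_le.
have /Gperm Gs := wE.
have tight : forall i, (A (k i) i (s i) + (g *+ k i)%:E)%E = (fine (mp_hat A g i (s i)))%:E.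
  apply: sum_tight => [i|]; first by rewrite fineK // mp_hat_le.
  by rewrite H -wE EFin_sum_fine.
apply/forallP => i; rewrite inE /= /graph_cap Gs andbT; apply/andP; split.
  by rewrite addeC tight fineK.
by move: (hfin i); rewrite fin_numE => /andP[].
Qed.

Lemma active_range (R : realType) n d (A : 'I_d.+1 -> 'M[\bar R]_n) (g : R) G :
  (forall k i j, A k i j != -oo%E) -> mp_regular A ->
  opt_or_sat (mp_hat A g) G ->
  let c := mp_roots (mp_charpoly A) in
  let lo := count (fun x => (g%:E < x)%E) c in
  let hi := count (fun x => (g%:E <= x)%E) c in
  let E := active_entries A g G in
  exists v : R, [/\
    forall (s : 'S_n) (k : {ffun 'I_n -> 'I_d.+1}),
      (v%:E <= \sum_(i < n) A (k i) i (s i) + (g *+ \sum_(i < n) k i)%:E)%E,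
    forall (s : 'S_n) (k : {ffun 'I_n -> 'I_d.+1}), monomial_in E s k <->
      (\sum_(i < n) A (k i) i (s i) + (g *+ \sum_(i < n) k i)%:E = v%:E)%E,
    forall (s : 'S_n) (k : {ffun 'I_n -> 'I_d.+1}), monomial_in E s k ->
      (lo <= \sum_(i < n) k i <= hi)%N,
    exists (s : 'S_n) (k : {ffun 'I_n -> 'I_d.+1}),
      monomial_in E s k /\ (\sum_(i < n) k i)%N = lo &
    exists (s : 'S_n) (k : {ffun 'I_n -> 'I_d.+1}),
      monomial_in E s k /\ (\sum_(i < n) k i)%N = hi].
Proof.
move=> ANy [l0 l0P] GE c lo hi E.
have PNy l : nth +oo%E (mp_charpoly A) l != -oo%E.
  by rewrite nth_mp_charpoly mp_charcoef_neqNy.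
rewrite -nth_mp_charpoly in l0P.
have fc := mp_factorization_mp_roots PNy l0P.
have [v [vE range vlo vhi]] := mp_active_range g PNy (mp_deg_finite l0P) fc.
have monE s k := @monomial_active R n d A g v _ G s k ANy vE vlo GE.
have ex l : (nth +oo%E (mp_charpoly A) l + (g *+ l)%:E = v%:E)%E ->
    exists (s : 'S_n) (k : {ffun 'I_n -> 'I_d.+1}),
      monomial_in E s k /\ (\sum_(i < n) k i)%N = l.
  move=> lv; have [s [k [kl cE]]] : exists (s : 'S_n) (k : {ffun 'I_n -> 'I_d.+1}),
    (\sum_(i < n) k i)%N = l /\ mp_charcoef A l = (\sum_(i < n) A (k i) i (s i))%E.
    by apply: mp_charcoef_attained; apply: contra_eq_neq lv => e; rewrite nth_mp_charpoly e.
  by exists s, k; split=> //; apply/monE; rewrite -cE kl -nth_mp_charpoly.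
exists v; split; [| exact: monE | | exact: ex | exact: ex].
  by move=> s k; exact: mp_eval_le_weight.
(* The shifted coefficient of the exponent is squeezed between the minimum and the shifted weight of
   the monomial. *)
move=> s k /monE kv; apply: range; apply/le_anti/andP; split.
  by rewrite -[leRHS]kv leeD2r // nth_mp_charpoly mp_charcoef_le.
rewrite -vE; case cE : (nth _ _ _) (PNy (\sum_i k i)%N) => [b| |] // _.
  by apply: le_trans (mp_eval_le g cE) _.
by rewrite leey.
Qed.

(** * Valuation, degree and root counts read off the coefficients *)

Lemma prod_XsubC_val0 (K : idomainType) (rs : seq K) :
  exists2 q : {poly K}, \prod_(z <- rs) ('X - z%:P) = q * 'X^(count_mem 0 rs) & q`_0 != 0.
Proof.
elim: rs => [|z rs [q qE q0]].
  by exists 1; rewrite ?big_nil ?mulr1 // coef1 oner_neq0.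
have [->|z0] := eqVneq z 0.
  by exists q => //; rewrite big_cons qE /= eqxx subr0 exprS mulrCA.
exists (('X - z%:P) * q); first by rewrite big_cons qE /= (negPf z0) mulrA.
by rewrite coef0M coefB coefX coefC /= sub0r mulf_neq0 // oppr_eq0.
Qed.

Lemma poly_range_facts (K : closedFieldType) (p : {poly K}) lo hi :
  (forall l, p`_l != 0 -> (lo <= l <= hi)%N) -> p`_lo != 0 -> p`_hi != 0 ->
  [/\ valuation 0 p = lo, poly_deg p = hi, size (poly_roots p) = hi
    & count_mem 0 (poly_roots p) = lo].
Proof.
move=> pl plo phi.
have p0 : p != 0 by apply: contraNneq phi => ->; rewrite coef0.
have sp : size p = hi.+1.
  apply/anti_leq/andP; split.
    apply/leq_sizeP => j lj; apply/eqP; apply: contraTT lj => /pl/andP[_].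
    by rewrite -ltnNge ltnS.
  by rewrite ltnNge; apply: contra phi => /leq_sizeP ->.
have [q qE q0] := prod_XsubC_val0 (poly_roots p).
have coefE l : p`_l = lead_coef p * (q * 'X^(count_mem 0 (poly_roots p)))`_l.
  by rewrite {1}(poly_rootsE p) qE coefZ.
have hasp : has (fun c => c != 0) p.
  by apply/(has_nthP 0); exists lo => //; rewrite sp ltnS; case/andP: (pl _ phi).
split.
- apply/anti_leq/andP; split.
    by rewrite leqNgt; apply/negP => /(before_find 0); rewrite plo.
  by have /pl/andP[] := nth_find 0 hasp.
- by rewrite /poly_deg sp.
- have := congr1 (size : {poly K} -> nat) (poly_rootsE p).
  by rewrite sp size_scale ?lead_coef_eq0 // size_prod_XsubC => -[].
apply/anti_leq/andP; split.
  rewrite leqNgt; apply: contra plo => l0.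
  by rewrite coefE coefMXn l0 mulr0.
have /pl/andP[] // : p`_(count_mem 0 (poly_roots p)) != 0.
by rewrite coefE coefMXn ltnn subnn mulf_neq0 // lead_coef_eq0.
Qed.

(* Quantifying over all supports [E] at once covers every slope [g] and every
   choice of the graph [G] with a single polynomial. *)
Definition generic_entries (K : numClosedFieldType) n d
    (y : 'I_d.+1 * 'I_n * 'I_n -> K) : Prop :=
  forall (E : {set 'I_d.+1 * 'I_n * 'I_n}) (s1 s2 : 'S_n) k1 k2,
    monomial_in E s1 k1 -> monomial_in E s2 k2 ->
    (forall (s : 'S_n) k, monomial_in E s k ->
       (\sum_(i < n) k1 i <= \sum_(i < n) k i <= \sum_(i < n) k2 i)%N) ->
    let p := char_poly_of (coef_on E y) in
    [/\ p`_(\sum_(i < n) k1 i) != 0, p`_(\sum_(i < n) k2 i) != 0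
      & simple_nonzero_roots p].

Lemma generic_generic_entries (K : numClosedFieldType) n d :
  generic (@generic_entries K n d).
Proof. by apply: generic_forall => E; apply: generic_extremes. Qed.

Lemma char_poly_active (R : realType) n d (A : 'I_d.+1 -> 'M[\bar R]_n) (g : R) G
    (y : 'I_d.+1 * 'I_n * 'I_n -> R[i]) :
  (forall k i j, A k i j != -oo%E) -> mp_regular A ->
  opt_or_sat (mp_hat A g) G -> generic_entries y ->
  let c := mp_roots (mp_charpoly A) in
  let lo := count (fun x => (g%:E < x)%E) c in
  let hi := count (fun x => (g%:E <= x)%E) c in
  let p := char_poly_of (coef_on (active_entries A g G) y) in
  [/\ forall l, p`_l != 0 -> (lo <= l <= hi)%N, p`_lo != 0, p`_hi != 0
    & simple_nonzero_roots p].
Proof.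
move=> ANy Areg GE ygen c lo hi p.
have [v [_ _ range [s1 [k1 [E1 k1E]]] [s2 [k2 [E2 k2E]]]]] := active_range ANy Areg GE.
rewrite -/lo -/hi -/c in range k1E k2E.
have := ygen _ s1 s2 k1 k2 E1 E2; rewrite k1E k2E => /(_ range)[plo phi ps].
by split=> // l; apply: coef_on_range.
Qed.

Lemma count_ge_eq (R : realType) (c : seq (\bar R)) (x : \bar R) :
  count (fun z => (x <= z)%E) c = (count_mem x c + count (fun z => (x < z)%E) c)%N.
Proof.
elim: c => //= z c ->; rewrite addnACA; congr (_ + _)%N.
by case: (ltgtP x z).
Qed.

Lemma count_neq0 (K : eqType) (z0 : K) (s : seq K) :
  count (fun z => z != z0) s = (size s - count_mem z0 s)%N.
Proof. by rewrite -(count_predC (pred1 z0) s) addKn. Qed.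

(** Here [lo = m'] and [hi = m + m'], so [hi - lo] counts the nonzero roots and [n * d - hi] is the
    defect of the degree. *)
Lemma a_gamma_eigenvalues (R : realType) n d (A : 'I_d.+1 -> 'M[\bar R]_n) (g : R) G
    (y : 'I_d.+1 * 'I_n * 'I_n -> R[i]) :
  (forall k i j, A k i j != -oo%E) -> mp_regular A -> generic_entries y ->
  opt_or_sat (mp_hat A g) G ->
  let m := mp_mult A g%:E in
  let m' := mp_mult_gt A g in
  let ag := coef_on (active_entries A g G) y in
  [/\ char_poly_of ag != 0,
      count (fun z => z != 0) (eigenvalues ag) = m,
      valuation 0 (char_poly_of ag) = m',
      count_mem 0 (eigenvalues ag) = m'
    & mult_infty ag = (n * d - m - m')%N].
Proof.
move=> ANy Areg ygen GE m m' ag.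
have [pl plo phi [p0 _]] := char_poly_active ANy Areg GE ygen.
have [pval pdeg psz pc0] := poly_range_facts pl plo phi.
have hiE := count_ge_eq (mp_roots (mp_charpoly A)) g%:E.
split=> //.
  by rewrite count_neq0 /eigenvalues psz pc0 hiE addnK.
by rewrite /mult_infty pdeg hiE subnDA.
Qed.

(** * Continuation of simple roots *)

Definition tends (T : Type) (R : realType) (F : set_system T) (f : T -> R[i])
    (a : R[i]) : Prop := f e @[e --> F] --> (a : R[i]^o).

Lemma real_gt0E (R : realType) (eps : R[i]) : 0 < eps -> eps = (complex.Re eps)%:C /\ 0 < complex.Re eps.
Proof.
move=> e0; have eE : (complex.Re eps)%:C = eps by rewrite RRe_real // gtr0_real.
by split=> //; rewrite -ltcR eE.
Qed.

(** Norms on [R[i]] take values in [R[i]], where positive elements are real; real radii therefore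
    suffice. *)
Lemma tendsP (T : Type) (R : realType) (F : set_system T) (FF : Filter F)
    (f : T -> R[i]) (a : R[i]) :
  tends F f a <-> (forall eps : R, 0 < eps -> \forall e \near F, `|a - f e| < eps%:C).
Proof.
rewrite /tends (@cvgrPdist_lt R[i] R[i]^o); split=> H eps e0.
  by apply: H; rewrite ltcR.
by have [-> e0'] := real_gt0E e0; apply: H.
Qed.

Lemma normr_RtoC (R : realType) (x : R) : `|x%:C| = `|x|%:C.
Proof.
have [x0|x0] := leP 0 x; first by rewrite !ger0_norm // lecR.
by rewrite !ltr0_norm ?ltcR // rmorphN.
Qed.

Lemma tends_real (T : Type) (R : realType) (F : set_system T) (FF : Filter F)
    (f : T -> R) (a : R) :
  f e @[e --> F] --> a -> tends F (fun e => (f e)%:C) a%:C.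
Proof.
move=> fa; apply/tendsP => eps e0.
move/(@cvgrPdist_lt R R): fa => /(_ _ e0); apply: filterS => e.
by rewrite -rmorphB normr_RtoC ltcR.
Qed.

Lemma eq_tends (T : Type) (R : realType) (F : set_system T) (f g : T -> R[i]) (a : R[i]) :
  f =1 g -> tends F g a -> tends F f a.
Proof. by move/funext->. Qed.

Lemma tends_cst (T : Type) (R : realType) (F : set_system T) (FF : Filter F) (a : R[i]) :
  tends F (fun=> a) a.
Proof. by apply/tendsP => eps e0; near=> e; rewrite subrr normr0 ltcR. Unshelve. all: by end_near. Qed.

Lemma tendsD (T : Type) (R : realType) (F : set_system T) (FF : Filter F)
    (f g : T -> R[i]) a b :
  tends F f a -> tends F g b -> tends F (fun e => f e + g e) (a + b).
Proof. by move=> h1 h2; exact: (@cvgD R[i] R[i]^o _ F FF f g a b h1 h2). Qed.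

Lemma tendsM (T : Type) (R : realType) (F : set_system T) (FF : Filter F)
    (f g : T -> R[i]) a b :
  tends F f a -> tends F g b -> tends F (fun e => f e * g e) (a * b).
Proof. by move=> h1 h2; exact: (@cvgM R[i] _ F FF f g a b h1 h2). Qed.

Lemma tendsV (T : Type) (R : realType) (F : set_system T) (FF : Filter F)
    (f : T -> R[i]) a : a != 0 -> tends F f a -> tends F (fun e => (f e)^-1) a^-1.
Proof. by move=> a0 h; exact: (@cvgV R[i] _ F FF f a a0 h). Qed.

Lemma tends_neq0 (T : Type) (R : realType) (F : set_system T) (FF : Filter F)
    (f : T -> R[i]) a : a != 0 -> tends F f a -> \forall e \near F, f e != 0.
Proof. by move=> a0 h; exact: (@cvgr_neq0 R[i] R[i]^o T F FF f a h a0). Qed.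

Lemma tends_near (T : Type) (R : realType) (F : set_system T) (FF : Filter F)
    (f g : T -> R[i]) a :
  (\forall e \near F, f e = g e) -> tends F f a -> tends F g a.
Proof.
move=> fg /tendsP fa; apply/tendsP => eps /fa; apply: filterS2 fg.
by move=> e ->.
Qed.

Lemma tends_sum (T : Type) (R : realType) (F : set_system T) (FF : Filter F)
    (I : Type) (s : seq I) (P : pred I) (f : I -> T -> R[i]) (a : I -> R[i]) :
  (forall i, P i -> tends F (f i) (a i)) ->
  tends F (fun e => \sum_(i <- s | P i) f i e) (\sum_(i <- s | P i) a i).
Proof.
move=> fa; elim: s => [|i s IH].
  by rewrite big_nil; under [X in tends _ X]eq_fun do rewrite big_nil; exact: tends_cst.
case Pi : (P i); rewrite big_cons Pi;
  under [X in tends _ X]eq_fun do rewrite big_cons Pi; last exact: IH.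
exact: tendsD (fa i Pi) IH.
Qed.

Lemma tends_prod (T : Type) (R : realType) (F : set_system T) (FF : Filter F)
    (I : Type) (s : seq I) (P : pred I) (f : I -> T -> R[i]) (a : I -> R[i]) :
  (forall i, P i -> tends F (f i) (a i)) ->
  tends F (fun e => \prod_(i <- s | P i) f i e) (\prod_(i <- s | P i) a i).
Proof.
move=> fa; elim: s => [|i s IH].
  by rewrite big_nil; under [X in tends _ X]eq_fun do rewrite big_nil; exact: tends_cst.
case Pi : (P i); rewrite big_cons Pi;
  under [X in tends _ X]eq_fun do rewrite big_cons Pi; last exact: IH.
exact: tendsM (fa i Pi) IH.
Qed.

Lemma tendsX (T : Type) (R : realType) (F : set_system T) (FF : Filter F)
    (f : T -> R[i]) a n : tends F f a -> tends F (fun e => f e ^+ n) (a ^+ n).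
Proof.
move=> fa; elim: n => [|n IH].
  by under [X in tends _ X]eq_fun do rewrite expr0; exact: tends_cst.
by under [X in tends _ X]eq_fun do rewrite exprS; rewrite exprS; exact: tendsM.
Qed.

Lemma at_right0P (R : realType) (P : R -> Prop) :
  (\forall e \near 0^'+, P e) <->
  (exists2 e1 : R, 0 < e1 & forall e, 0 < e < e1 -> P e).
Proof.
split=> [|[e1 e10 H]].
  move=> /nbhs_normP[e1 /= e10 H]; exists e1 => // e /andP[e0 ee1].
  by apply: H => //=; rewrite sub0r normrN gtr0_norm.
near=> e; apply: H; apply/andP; split; near: e.
  exact: nbhs_right_gt.
exact: nbhs_right_lt.
Unshelve. all: by end_near. Qed.

(** The quotient [p'(w) / p(w)] is the sum of [1 / (w - z)] over at most [N] roots, so some root is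
    close to [w]. Only a bound on the degree enters, which keeps the estimate uniform when leading
    coefficients tend to 0. *)
Lemma root_dist_bound (K : numClosedFieldType) (p : {poly K}) N w :
  (size p <= N.+1)%N -> p^`().[w] != 0 ->
  exists z, root p z /\ `|w - z| * `|p^`().[w]| <= N.+1%:R * `|p.[w]|.
Proof.
move=> sp p'0; have p0 : p != 0 by apply: contraNneq p'0 => ->; rewrite deriv0 horner0.
have [pw|pw] := eqVneq p.[w] 0.
  by exists w; rewrite rootE pw subrr normr0 mul0r mulr0 eqxx.
have [/hasP[z zr H]|] := boolP (has (fun z => `|w - z| * `|p^`().[w]| <= N.+1%:R * `|p.[w]|) (poly_roots p)).
  by exists z; rewrite -mem_poly_roots.
rewrite -all_predC => /allP /= H; exfalso.
(* [N.+1] exceeds the number of roots, so the weak inequality [bound] is already contradictory. *)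
pose dl := N.+1%:R * `|p.[w]| / `|p^`().[w]|.
have dl0 : 0 <= dl by rewrite divr_ge0 ?mulr_ge0.
have Hd z : z \in poly_roots p -> dl <= `|w - z|.
  move=> /H; rewrite -real_ltNge ?rpredM ?normr_real ?realn // => /ltW.
  by rewrite ler_pdivrMr ?normr_gt0.
(* The estimate of the logarithmic derivative, with denominators cleared. *)
have bound (rs : seq K) : (forall z, z \in rs -> dl <= `|w - z|) ->
    `|(\prod_(z <- rs) ('X - z%:P))^`().[w]| * dl <=
    (size rs)%:R * `|(\prod_(z <- rs) ('X - z%:P)).[w]|.
  elim: rs => [|z rs IH] Hz; first by rewrite big_nil derivC horner0 normr0 !mul0r.
  rewrite big_cons derivM derivXsubC mul1r hornerD !hornerM hornerXsubC.
  set q := \prod_(_ <- _) _ in IH *.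
  have Hq : `|q^`().[w]| * dl <= (size rs)%:R * `|q.[w]|.
    by apply: IH => z' zr; apply: Hz; rewrite in_cons zr orbT.
  have h1 : `|q.[w] + (w - z) * q^`().[w]| <= `|q.[w]| + `|w - z| * `|q^`().[w]|.
    by rewrite -normrM ler_normD.
  have h2 : `|q.[w]| * dl <= `|q.[w]| * `|w - z| by rewrite ler_wpM2l // Hz // mem_head.
  have h3 := ler_wpM2l (normr_ge0 (w - z)) Hq.
  apply: le_trans (ler_wpM2r dl0 h1) _.
  rewrite mulrDl normrM; apply: le_trans (lerD h2 (_ : _ <= _)) _.
    by rewrite -mulrA; exact: h3.
  by rewrite -natr1 mulrDl mul1r addrC [in X in _ + X <= _]mulrC mulrCA.
have {}bound : `|p^`().[w]| * dl <= (size (poly_roots p))%:R * `|p.[w]|.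
  have e1 : p.[w] = lead_coef p * (\prod_(z <- poly_roots p) ('X - z%:P)).[w].
    by rewrite {1}(poly_rootsE p) hornerZ.
  have e2 : p^`().[w] = lead_coef p * (\prod_(z <- poly_roots p) ('X - z%:P))^`().[w].
    by rewrite {1}(poly_rootsE p) derivZ hornerZ.
  by rewrite e1 e2 !normrM -mulrA [leRHS]mulrCA ler_wpM2l // bound.
have dlE : `|p^`().[w]| * dl = N.+1%:R * `|p.[w]|.
  by rewrite /dl mulrC divfK // normr_eq0.
move: bound; rewrite dlE ler_pM2r ?normr_gt0 // ler_nat.
have := congr1 (size : {poly K} -> nat) (poly_rootsE p).
rewrite size_scale ?lead_coef_eq0 // size_prod_XsubC => sE.
by move: sp; rewrite sE ltnS ltnNge => ->.
Qed.

Lemma poly_wide (K : nzRingType) (p : {poly K}) N :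
  (size p <= N)%N -> p = \sum_(l < N) p`_l *: 'X^l.
Proof.
move=> sp; rewrite -poly_def; apply/polyP => l; rewrite coef_poly.
by case: ltnP => // Nl; rewrite nth_default // (leq_trans sp).
Qed.

Lemma size_deriv_le (K : nzRingType) (p : {poly K}) N :
  (size p <= N)%N -> (size p^`() <= N)%N.
Proof.
move=> sp; apply/leq_sizeP => j Nj.
by rewrite coef_deriv nth_default ?mul0rn // (leq_trans sp) // ltnW.
Qed.

Lemma tends_horner (T : Type) (R : realType) (F : set_system T) (FF : Filter F)
    (r : T -> {poly R[i]}) (p : {poly R[i]}) N w :
  (forall e, size (r e) <= N)%N -> (size p <= N)%N ->
  (forall l, tends F (fun e => (r e)`_l) p`_l) ->
  tends F (fun e => (r e).[w]) p.[w].
Proof.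
move=> rN pN rp; rewrite (horner_coef_wide _ pN).
under [X in tends _ X]eq_fun do rewrite (horner_coef_wide _ (rN _)).
by apply: tends_sum => l _; apply: tendsM => //; exact: tends_cst.
Qed.

(** The value of [r e] at [w] tends to 0 and that of its derivative does not, so the bound of
    [root_dist_bound] tends to 0. *)
Lemma root_near (T : Type) (R : realType) (F : set_system T) (FF : Filter F)
    (r : T -> {poly R[i]}) (p : {poly R[i]}) N w (rho : R) :
  (forall e, size (r e) <= N.+1)%N -> (size p <= N.+1)%N ->
  (forall l, tends F (fun e => (r e)`_l) p`_l) ->
  root p w -> ~~ root p^`() w -> 0 < rho ->
  \forall e \near F, exists z, root (r e) z /\ `|w - z| < rho%:C.
Proof.
move=> rN pN rp /eqP pw p'w rho0.
have rp' l : tends F (fun e => (r e)^`()`_l) p^`()`_l.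
  rewrite coef_deriv -mulr_natr.
  under [X in tends _ X]eq_fun do rewrite coef_deriv -mulr_natr.
  by apply: tendsM; [exact: rp | exact: tends_cst].
have t := tends_horner (w := w) FF rN pN rp.
have t' := tends_horner (w := w) FF (fun e => size_deriv_le (rN e)) (size_deriv_le pN) rp'.
have := tendsM FF t (tendsV FF p'w t'); rewrite pw mul0r.
move/tendsP => /(_ (rho / N.+1%:R)); rewrite divr_gt0 ?ltr0n // => /(_ isT) nq.
have nz := tends_neq0 FF p'w t'.
apply: filterS2 nq nz => e; rewrite sub0r normrN => eq ez.
have [z [rz zb]] := root_dist_bound (rN e) ez.
exists z; split=> //.
have p0 : 0 < `|(r e)^`().[w]| by rewrite normr_gt0.
rewrite -(ltr_pM2r p0); apply: le_lt_trans zb _.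
move: eq; rewrite normrM normfV ltr_pdivrMr //.
by rewrite rmorphM fmorphV rmorph_nat mulrAC ltr_pdivlMr ?ltr0n // mulrC.
Qed.

(** The quotient [(p(u) - p(v)) / (u - v)] written as a polynomial in [u] and [v], hence meaningful
    on the diagonal. For [l = 0] the inner sum is empty. *)
Definition divided_difference (K : nzRingType) N (p : {poly K}) (u v : K) : K :=
  \sum_(l < N) p`_l * \sum_(i < l) u ^+ (l.-1 - i) * v ^+ i.

Lemma divided_differenceE (K : comNzRingType) N (p : {poly K}) u v : (size p <= N)%N ->
  p.[u] - p.[v] = (u - v) * divided_difference N p u v.
Proof.
move=> sp; rewrite !(horner_coef_wide _ sp) -sumrB /divided_difference big_distrr.
apply: eq_bigr => l _ /=.
by rewrite -mulrBr subrXX mulrCA.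
Qed.

Lemma divided_difference_diag (K : comNzRingType) N (p : {poly K}) u : (size p <= N)%N ->
  divided_difference N p u u = p^`().[u].
Proof.
move=> sp; rewrite [in RHS](poly_wide sp) raddf_sum horner_sum /=.
apply: eq_bigr => l _; rewrite derivZ derivXn hornerZ hornerMn hornerXn.
congr (_ * _); rewrite (eq_bigr (fun=> u ^+ l.-1)) ?sumr_const ?card_ord // => i _.
rewrite -exprD subnK //.
by rewrite -ltnS prednK ?ltn_ord // (leq_ltn_trans (leq0n i)) ?ltn_ord.
Qed.

(** Local uniqueness of roots: the divided difference has the limit [p'(w) != 0] at the diagonal,
    and a nonzero value excludes two distinct roots in the disc. *)
Lemma divided_difference_near (T : Type) (R : realType) (F : set_system T) (FF : Filter F)
    (r : T -> {poly R[i]}) (p : {poly R[i]}) N w :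
  (size p <= N)%N ->
  (forall l, tends F (fun e => (r e)`_l) p`_l) -> ~~ root p^`() w ->
  exists2 rho : R, 0 < rho & \forall e \near F, forall u v,
    `|w - u| < rho%:C -> `|w - v| < rho%:C -> divided_difference N (r e) u v != 0.
Proof.
move=> pN rp p'w.
pose G := nbhs (w : R[i]^o).
(* Joint convergence in [e], [u] and [v] yields one radius valid for all [u] and [v]. *)
pose H := filter_prod F (filter_prod G G).
have FH : Filter H by exact: filter_prod_filter.
have tF (f : T -> R[i]) (a : R[i]) : tends F f a -> tends H (fun x => f x.1) a.
  by move=> fa; apply: (@cvg_comp _ _ _ fst f H F _ (@cvg_fst _ _ F _ _) fa).
have tu : tends H (fun x => x.2.1) w.
  apply: (@cvg_comp _ _ _ snd fst H (filter_prod G G) _ (@cvg_snd _ _ F _ _)).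
  exact: cvg_fst.
have tv : tends H (fun x => x.2.2) w.
  apply: (@cvg_comp _ _ _ snd snd H (filter_prod G G) _ (@cvg_snd _ _ F _ _)).
  exact: cvg_snd.
have : tends H (fun x => divided_difference N (r x.1) x.2.1 x.2.2)
    (divided_difference N p w w).
  apply: tends_sum => l _; apply: tendsM; first exact: (tF (fun e => (r e)`_l) _ (rp l)).
  by apply: tends_sum => i _; apply: tendsM; [exact: (tendsX FH tu)|exact: (tendsX FH tv)].
move=> td; have := tends_neq0 (F := H) _ _ td; rewrite divided_difference_diag //.
move=> /(_ FH p'w).
case=> -[A B] /= [FA [[B1 B2] /= [/nbhs_normP[e1 /= e10 H1] /nbhs_normP[e2 /= e20 H2]] subB]] subAB.
have [e1E e10'] := real_gt0E e10; have [e2E e20'] := real_gt0E e20.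
exists (Num.min (complex.Re e1) (complex.Re e2)); first by rewrite lt_min e10'.
apply: filterS FA => e Ae u v wu wv; apply: (subAB (e, (u, v))); split=> //.
apply: subB; split; [apply: H1 | apply: H2] => /=.
  by rewrite e1E; apply: lt_le_trans wu _; rewrite lecR ge_min lexx.
by rewrite e2E; apply: lt_le_trans wv _; rewrite lecR ge_min lexx orbT.
Qed.

(** [f e] is the only root of [r e] in a fixed disc about [z]. Every root that [root_near] finds in
    that disc is thus a value of [f], which gives both the continuity and the limit at 0. *)
Lemma root_branch (R : realType) (r : R -> {poly R[i]}) (q : {poly R[i]}) N z (e0 : R) :
  0 < e0 -> (forall e, size (r e) <= N.+1)%N -> (size q <= N.+1)%N ->
  (forall l e, 0 < e < e0 -> tends (nbhs e) (fun e => (r e)`_l) (r e)`_l) ->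
  (forall l, tends (0 : R)^'+ (fun e => (r e)`_l) q`_l) ->
  root q z -> ~~ root q^`() z ->
  exists (f : R -> R[i]) (e1 : R), [/\ 0 < e1 <= e0,
    forall e, 0 < e < e1 -> root (r e) (f e) /\ tends (nbhs e) f (f e)
    & tends (0 : R)^'+ f z].
Proof.
move=> e00 rN qN rc rq qz q'z.
have [rho rho0 dd0] := divided_difference_near _ qN rq q'z.
have ex0 := root_near _ rN qN rq qz q'z rho0.
have /at_right0P[e1 e10 H] : \forall e \near (0 : R)^'+,
    [/\ e < e0, forall u v, `|z - u| < rho%:C -> `|z - v| < rho%:C ->
        divided_difference N.+1 (r e) u v != 0
      & exists z', root (r e) z' /\ `|z - z'| < rho%:C].
  near=> e; split; near: e; [exact: nbhs_right_lt | exact: dd0 | exact: ex0].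
pose f e := xget 0 [set z' | root (r e) z' /\ `|z - z'| < rho%:C].
have fP e : 0 < e < e1 -> root (r e) (f e) /\ `|z - f e| < rho%:C.
  by move=> /H[_ _ ex]; exact: (xgetPex 0 ex).
have funiq e z' : 0 < e < e1 -> root (r e) z' -> `|z - z'| < rho%:C -> z' = f e.
  move=> ee1 rz' zz'; have [rf zf] := fP _ ee1; have [_ dd _] := H _ ee1.
  have := divided_differenceE z' (f e) (rN e).
  rewrite (eqP rz') (eqP rf) subrr => /esym/eqP; rewrite mulf_eq0 (negPf (dd _ _ zz' zf)).
  by rewrite orbF subr_eq0 => /eqP.
exists f, (Num.min e1 e0); split.
- by rewrite lt_min e10 e00 ge_min lexx orbT.
- move=> e; rewrite lt_min andbA => /andP[ee1 ee0]; have [rf zf] := fP _ ee1; split=> //.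
  (* The divided difference on the diagonal is the derivative: [f e] is simple, and [root_near]
     applies with [r e] itself as the limit. *)
  have df : ~~ root (r e)^`() (f e).
    by have [_ dd _] := H _ ee1; rewrite rootE -(divided_difference_diag _ (rN e)) dd.
  have [e00' e01] := andP ee1.
  apply/tendsP => eps eps0.
  (* [rho - k] is the room between [f e] and the boundary of the disc. *)
  pose k := complex.Re `|z - f e|.
  have kE : `|z - f e| = k%:C by rewrite RRe_real // normr_real.
  have krho : 0 < rho - k by rewrite subr_gt0 -ltcR -kE.
  have m0 : 0 < Num.min eps (rho - k) by rewrite lt_min eps0.
  have ee0' : 0 < e < e0 by rewrite e00' ee0.
  have nr := root_near _ rN (rN e) (fun l => rc l e ee0') rf df m0.
  near=> e2.
  have [z' [rz' zz']] : exists z', root (r e2) z' /\ `|f e - z'| < (Num.min eps (rho - k))%:C.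
    by near: e2; exact: nr.
  have <- : z' = f e2.
    apply: funiq => //.
      by apply/andP; split; near: e2; [exact: lt_nbhsr | exact: lt_nbhsl].
    rewrite -(subrKA (f e)) (le_lt_trans (ler_normD _ _)) //.
    have -> : rho%:C = k%:C + (rho - k)%:C by rewrite -rmorphD addrC subrK.
    by rewrite kE ltrD2l (lt_le_trans zz') // lecR ge_min lexx orbT.
  by rewrite (lt_le_trans zz') // lecR ge_min lexx.
apply/tendsP => eps eps0.
have m0 : 0 < Num.min eps rho by rewrite lt_min eps0.
have nr := root_near _ rN qN rq qz q'z m0.
near=> e2.
have [z' [rz' zz']] : exists z', root (r e2) z' /\ `|z - z'| < (Num.min eps rho)%:C.
  by near: e2; exact: nr.
have <- : z' = f e2.
  apply: funiq => //.
    by apply/andP; split; near: e2; [exact: nbhs_right_gt | exact: nbhs_right_lt].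
  by rewrite (lt_le_trans zz') // lecR ge_min lexx orbT.
by rewrite (lt_le_trans zz') // lecR ge_min lexx.
Unshelve. all: by end_near. Qed.

(** * Rescaled characteristic polynomials and branches *)

Lemma powR_tends (R : realType) (e s : R) :
  0 < e -> tends (nbhs e) (fun x => (x `^ s)%:C) (e `^ s)%:C.
Proof.
move=> e0; apply: tends_real.
have h : expR (s * ln x) @[x --> e] --> expR (s * ln e).
  apply: (@cvg_comp _ _ _ (fun x => s * ln x) expR _ (nbhs (s * ln e))).
    by apply: cvgMr; exact: continuous_ln.
  exact: continuous_expR.
have -> : e `^ s = expR (s * ln e) by rewrite /powR gt_eqF.
apply: cvg_trans h; apply: near_eq_cvg; near=> x.
by rewrite /powR gt_eqF //; near: x; exact: lt_nbhsr.
Unshelve. all: by end_near. Qed.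

Lemma powR_tends0 (R : realType) (s : R) :
  0 <= s -> tends (0 : R)^'+ (fun e => (e `^ s)%:C) (s == 0)%:R.
Proof.
rewrite le_eqVlt eq_sym => /predU1P[->|s0].
  rewrite eqxx; apply: eq_tends => [e|]; [by rewrite powRr0 | exact: tends_cst].
by rewrite gt_eqF //; apply: (tends_real _ (a := 0)); exact: powR_cvg0.
Qed.

Lemma powRD_gt0 (R : realType) (e r s : R) : 0 < e -> e `^ (r + s) = e `^ r * e `^ s.
Proof. by move=> e0; rewrite powRD //; apply/implyP => _; rewrite gt_eqF. Qed.

Lemma powR_sum (R : realType) (I : finType) (e : R) (w : I -> R) :
  0 < e -> e `^ (\sum_i w i) = \prod_i e `^ w i.
Proof.
move=> e0; apply: (big_morph (powR e) (id1 := 1) (op1 := *%R)); last exact: powRr0.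
by move=> x y; exact: powRD_gt0.
Qed.

(** Each factor is normalized by its own exponent; what remains is [e] to the power [t - v >= 0],
    which tends to 1 or 0. An infinite exponent makes the product vanish near 0. *)
Lemma monomial_tends (R : realType) n d (A : 'I_d.+1 -> 'M[\bar R]_n)
    (y : 'I_d.+1 * 'I_n * 'I_n -> R[i]) (F : 'I_d.+1 -> 'M[R -> R[i]]_n) (g v : R)
    (s : 'S_n) (k : {ffun 'I_n -> 'I_d.+1}) :
  (forall k i j, A k i j != -oo%E) ->
  (forall k i j, asymp (F k i j) (y (k, i, j)) (A k i j)) ->
  let t := (\sum_(i < n) A (k i) i (s i) + (g *+ \sum_(i < n) k i)%:E)%E in
  (v%:E <= t)%E ->
  tends (0 : R)^'+
    (fun e => (e `^ (g *+ \sum_(i < n) k i - v))%:C * \prod_(i < n) F (k i) i (s i) e)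
    (if t == v%:E then \prod_(i < n) y (k i, i, s i) else 0).
Proof.
move=> ANy Fy t vt.
have [[i Ai]|H] := pselect (exists i, A (k i) i (s i) = +oo%E).
  have -> : t = +oo%E.
    have -> : t = (\sum_(i < n) (A (k i) i (s i) + (g *+ k i)%:E))%E by rewrite sum_shift.
    apply/esum_eqyP; first by move=> j _; case: (A (k j) j (s j)) (ANy (k j) j (s j)).
    by exists i; rewrite mem_index_enum Ai.
  apply: (@tends_near _ _ _ _ (fun=> 0)); last exact: tends_cst.
  have := Fy (k i) i (s i); rewrite /asymp Ai; apply: filterS => e Fe.
  by rewrite [X in _ = _ * X](bigD1 i) //= Fe mul0r mulr0.
have /choice[w wE] : forall i, exists w : R, A (k i) i (s i) = w%:E.
  move=> i; case Ai : (A (k i) i (s i)) (ANy (k i) i (s i)) => [w| |] // _; first by exists w.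
  by case: H; exists i.
have tE : t = (\sum_i w i + g *+ \sum_(i < n) k i)%:E.
  by rewrite /t EFinD -sumEFin; under eq_bigr do rewrite wE.
pose dl := \sum_i w i + g *+ (\sum_(i < n) k i) - v.
have dl0 : 0 <= dl by rewrite subr_ge0 -lee_fin -tE.
have tv : (t == v%:E) = (dl == 0) by rewrite tE eqe subr_eq0.
have -> : (if t == v%:E then \prod_(i < n) y (k i, i, s i) else 0)
    = (dl == 0)%:R * \prod_(i < n) y (k i, i, s i).
  by rewrite tv; case: eqP; rewrite ?mul1r ?mul0r.
apply: (@tends_near _ _ _ _ (fun e => (e `^ dl)%:C *
    \prod_(i < n) ((e `^ (- w i))%:C * F (k i) i (s i) e))).
  near=> e; have e0 : 0 < e by near: e; exact: nbhs_right_gt.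
  rewrite big_split /= mulrA -rmorph_prod -powR_sum // -rmorphM; congr (_%:C * _).
  rewrite -powRD_gt0 // sumrN; congr (_ `^ _); rewrite /dl; ring.
apply: tendsM; first exact: powR_tends0.
apply: tends_prod => i _; have := Fy (k i) i (s i).
by rewrite /asymp wE.
Unshelve. all: by end_near. Qed.

(** The fixed length makes the size bound required by [root_branch] hold at every [e]. *)
Definition rescale (R : realType) N (g v : R) (P : R -> {poly R[i]}) (e : R) : {poly R[i]} :=
  \poly_(l < N.+1) ((e `^ (g *+ l - v))%:C * (P e)`_l).

Lemma coef_rescale (R : realType) N (g v : R) (P : R -> {poly R[i]}) e l :
  (rescale N g v P e)`_l =
    if (l < N.+1)%N then (e `^ (g *+ l - v))%:C * (P e)`_l else 0.
Proof. by rewrite coef_poly. Qed.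

Lemma rescale_neq0 (R : realType) N (g v : R) (P : R -> {poly R[i]}) e l :
  (rescale N g v P e)`_l != 0 -> (P e)`_l != 0.
Proof.
rewrite coef_rescale; case: ifP => _; last by rewrite eqxx.
by apply: contra_neq => ->; rewrite mulr0.
Qed.

Lemma rescale_continuous (R : realType) N (g v : R) (P : R -> {poly R[i]}) (e : R) l :
  0 < e -> tends (nbhs e) (fun x => (P x)`_l) (P e)`_l ->
  tends (nbhs e) (fun x => (rescale N g v P x)`_l) (rescale N g v P e)`_l.
Proof.
move=> e0 Pe; rewrite coef_rescale; apply: eq_tends => [x|]; first by rewrite coef_rescale.
have [ll|ll] := ltnP l N.+1; last exact: tends_cst.
exact: (tendsM _ (powR_tends e0) Pe).
Qed.

Lemma root_rescale (R : realType) N (g v : R) (P : R -> {poly R[i]}) e z :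
  0 < e -> (size (P e) <= N.+1)%N ->
  root (rescale N g v P e) z -> root (P e) ((e `^ g)%:C * z).
Proof.
move=> e0 PN; rewrite !rootE (horner_coef_wide _ PN).
rewrite (horner_coef_wide _ (size_poly _ _)) => /eqP H.
have ev : (e `^ (- v))%:C != 0.
  by rewrite gt_eqF // ltcR powR_gt0.
rewrite -(inj_eq (mulfI ev)) mulr0 -[X in _ == X]H big_distrr /=; apply/eqP/eq_bigr => l _.
rewrite coef_rescale ltn_ord exprMn -rmorphXn /= -powR_mulrn ?powR_ge0 // -powRrM.
have -> : g *+ l - v = - v + g * l%:R by rewrite addrC mulr_natr.
by rewrite powRD_gt0 // rmorphM /=; ring.
Qed.

Lemma coef_matgerm (R : realType) n d (F : 'I_d.+1 -> 'M[R -> R[i]]_n) l e :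
  (char_poly_of (matgerm_at F e))`_l = \sum_(s : 'S_n)
    \sum_(k : {ffun 'I_n -> 'I_d.+1} | (\sum_(i < n) k i)%N == l)
      (-1) ^+ s * \prod_(i < n) F (k i) i (s i) e.
Proof.
rewrite coef_char_poly_of; apply: eq_bigr => s _; apply: eq_bigr => k _.
by congr (_ * _); apply: eq_bigr => i _; rewrite mxE.
Qed.

Lemma rescale_tends (R : realType) n d (A : 'I_d.+1 -> 'M[\bar R]_n)
    (y : 'I_d.+1 * 'I_n * 'I_n -> R[i]) (F : 'I_d.+1 -> 'M[R -> R[i]]_n) (g v : R)
    (E : {set 'I_d.+1 * 'I_n * 'I_n}) l :
  (forall k i j, A k i j != -oo%E) ->
  (forall k i j, asymp (F k i j) (y (k, i, j)) (A k i j)) ->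
  (forall (s : 'S_n) (k : {ffun 'I_n -> 'I_d.+1}),
    (v%:E <= \sum_(i < n) A (k i) i (s i) + (g *+ \sum_(i < n) k i)%:E)%E) ->
  (forall (s : 'S_n) (k : {ffun 'I_n -> 'I_d.+1}), monomial_in E s k <->
    (\sum_(i < n) A (k i) i (s i) + (g *+ \sum_(i < n) k i)%:E = v%:E)%E) ->
  tends (0 : R)^'+
    (fun e => (rescale (n * d) g v (fun e => char_poly_of (matgerm_at F e)) e)`_l)
    (char_poly_of (coef_on E y))`_l.
Proof.
move=> ANy Fy le_v monE.
apply: eq_tends => [e|]; first by rewrite coef_rescale.
have [ll|ll] := ltnP l (n * d).+1; last first.
  by rewrite nth_default; [exact: tends_cst | exact: leq_trans (size_char_poly_of _) ll].
apply: eq_tends => [e|]; first by rewrite coef_matgerm big_distrr.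
rewrite coef_char_poly_of; apply: tends_sum => s _.
apply: eq_tends => [e|]; first by rewrite big_distrr.
apply: tends_sum => k /eqP kl.
apply: (@eq_tends _ _ _ _ (fun e => (-1) ^+ s * ((e `^ (g *+ (\sum_(i < n) k i) - v))%:C *
    \prod_(i < n) F (k i) i (s i) e))) => [e|]; first by rewrite /= mulrCA kl.
apply: tendsM; first exact: tends_cst.
have := @monomial_tends R n d A y F g v s k ANy Fy (le_v s k).
rewrite prod_coef_on; congr (tends _ _ _).
by apply/esym; case: ifP => [/monE->|/negP mN]; rewrite ?eqxx //; case: eqP => // /monE.
Qed.

Lemma coef_continuous (R : realType) n d (F : 'I_d.+1 -> 'M[R -> R[i]]_n) :
  (forall k i j, is_germ (F k i j)) ->
  exists2 e0 : R, 0 < e0 & forall l e, 0 < e < e0 ->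
    tends (nbhs e) (fun e => (char_poly_of (matgerm_at F e))`_l)
      (char_poly_of (matgerm_at F e))`_l.
Proof.
move=> Fgerm.
have /at_right0P[e0 e00 H] : \forall e \near (0 : R)^'+,
    forall x : 'I_d.+1 * 'I_n * 'I_n,
    tends (nbhs e) (F x.1.1 x.1.2 x.2) (F x.1.1 x.1.2 x.2 e).
  apply: filter_forall => -[[k i] j] /=; apply/at_right0P.
  by have [e1 [e10 [c _]]] := Fgerm k i j; exists e1.
exists e0; first exact: e00.
move=> l e ee0; rewrite [X in tends _ _ X]coef_matgerm.
apply: eq_tends => [x|]; first by rewrite coef_matgerm.
apply: tends_sum => s _; apply: tends_sum => k _; apply: tendsM; first exact: tends_cst.
by apply: tends_prod => i _; exact: (H e ee0 (k i, i, s i)).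
Qed.

Lemma eigen_branch (R : realType) n d (A : 'I_d.+1 -> 'M[\bar R]_n)
    (y : 'I_d.+1 * 'I_n * 'I_n -> R[i]) (F : 'I_d.+1 -> 'M[R -> R[i]]_n) (g : R) G z :
  (forall k i j, A k i j != -oo%E) -> mp_regular A ->
  generic_entries y -> (forall k i j, is_germ (F k i j)) ->
  (forall k i j, asymp (F k i j) (y (k, i, j)) (A k i j)) ->
  opt_or_sat (mp_hat A g) G ->
  let p := char_poly_of (coef_on (active_entries A g G) y) in
  z != 0 -> root p z ->
  exists f : R -> R[i], [/\ is_germ f, tends (0 : R)^'+ (fun e => (e `^ (- g))%:C * f e) z
    & \forall e \near (0 : R)^'+, root (char_poly_of (matgerm_at F e)) (f e)].
Proof.
move=> ANy Areg ygen Fgerm Fy GE p z0 pz.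
have [_ _ _ [_ ps]] := char_poly_active ANy Areg GE ygen.
have [v [le_v monE _ _ _]] := active_range ANy Areg GE.
have [e0 e00 Fc] := coef_continuous Fgerm.
pose P e := char_poly_of (matgerm_at F e).
have rN e : (size (rescale (n * d) g v P e) <= (n * d).+1)%N by exact: size_poly.
have rc l e : 0 < e < e0 ->
    tends (nbhs e) (fun e => (rescale (n * d) g v P e)`_l) (rescale (n * d) g v P e)`_l.
  move=> ee0; apply: rescale_continuous; last exact: Fc.
  by case/andP: ee0.
have rt l := @rescale_tends R n d A y F g v _ l ANy Fy le_v monE.
have [f [e1 [/andP[e10 e1e0] fP ft]]] :=
  root_branch e00 rN (size_char_poly_of _) rc rt pz (ps z z0 pz).
exists (fun e => (e `^ g)%:C * f e); split.
(* As [g + k > 0], the branch times [e^k] tends to 0, hence is eventually at most 1 in modulus: this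
   is the growth bound of a germ. *)
- pose k := `|g| + 1.
  have k0 : 0 < k by rewrite ltr_wpDl.
  have gk : 0 < g + k.
    by have := ler_norm (- g); rewrite normrN /k => ?; lra.
  have : tends (0 : R)^'+ (fun e => (e `^ (g + k))%:C * f e) 0.
    have -> : 0 = (g + k == 0)%:R * z by rewrite gt_eqF // mul0r.
    exact: (tendsM _ (powR_tends0 (ltW gk)) ft).
  move=> /tendsP/(_ 1 ltr01)/at_right0P[e2 e20 e2P].
  exists (Num.min e1 e2); split; first by rewrite lt_min e10.
  split=> [e|].
    rewrite lt_min andbA => /andP[ee1 _]; apply: tendsM; last by case: (fP _ ee1).
    by apply: powR_tends; case/andP: ee1.
  exists k => // e; rewrite lt_min => /and3P[ee0 ee1 ee2].
  have := e2P e; rewrite ee0 ee2 => /(_ isT) /ltW; rewrite sub0r normrN.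
  rewrite addrC powRD_gt0 // rmorphM -mulrA normrM => H.
  have ek : 0 < (e `^ k)%:C by rewrite ltcR powR_gt0.
  by rewrite powRN fmorphV /= -[leRHS]mul1r ler_pdivlMr // mulrC -(gtr0_norm ek).
- apply: (@tends_near _ _ _ _ f) => //; near=> e.
  have ee : 0 < e by near: e; exact: nbhs_right_gt.
  by rewrite mulrA -rmorphM -powRD_gt0 // addNr powRr0 mul1r.
near=> e.
have ee : 0 < e < e1.
  by apply/andP; split; near: e; [exact: nbhs_right_gt | exact: nbhs_right_lt].
have [rf _] := fP _ ee; have [ee' _] := andP ee.
exact: root_rescale (size_char_poly_of _) rf.
Unshelve. all: by end_near. Qed.

(** * The main theorem *)

(** Pigeonhole: the distinct values [vs] fill all the places left by the copies of [z0], so none is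
    repeated in [rs]. *)
Lemma perm_eq_nseq_uniq (K : eqType) (z0 : K) (rs vs : seq K) a :
  uniq vs -> z0 \notin vs -> {subset vs <= rs} ->
  count_mem z0 rs = a -> size rs = (a + size vs)%N ->
  perm_eq rs (nseq a z0 ++ vs).
Proof.
move=> uvs z0vs vsrs ca srs; rewrite -(perm_filterC (pred1 z0) rs) perm_sym.
have -> : [seq x <- rs | pred1 z0 x] = nseq a z0.
  have /all_pred1P -> := filter_all (pred1 z0) rs.
  by rewrite size_filter ca.
rewrite perm_cat2l.
have sub : {subset vs <= [seq x <- rs | predC (pred1 z0) x]}.
  move=> x xvs; rewrite mem_filter vsrs // andbT /=.
  by apply: contraNneq z0vs => <-.
have sz : (size [seq x <- rs | predC (pred1 z0) x] <= size vs)%N.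
  by rewrite size_filter -(leq_add2l a) -srs -ca count_predC.
have [_ eqi] := uniq_min_size uvs sub sz.
by apply: uniq_perm => //; exact: leq_size_uniq uvs sub sz.
Qed.

Lemma uniq_nonzero_roots (K : closedFieldType) (p : {poly K}) :
  simple_nonzero_roots p -> uniq [seq z <- poly_roots p | z != 0].
Proof.
move=> [p0 ps]; apply: count_mem_uniq => z; rewrite mem_filter count_filter.
have [z0|z0] /= := eqVneq z 0.
  apply/eqP; rewrite -leqn0 leqNgt -has_count; apply/hasPn => x _ /=.
  by rewrite z0; case: eqP.
rewrite (eq_count (a2 := pred1 z)) => [|x /=]; last by case: eqP => // ->; rewrite z0.
have [zp|zp] := boolP (z \in poly_roots p); last by rewrite (count_memPn zp).
have pr := perm_to_rem zp; rewrite (seq.permP pr) /= eqxx.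
rewrite (count_memPn _) //; apply/negP => zr.
have rz : root p z by rewrite -mem_poly_roots.
case/negP: (ps z z0 rz).
rewrite (poly_rootsE p) (perm_big _ pr) big_cons derivZ derivM derivXsubC mul1r.
rewrite rootE hornerZ hornerD hornerM hornerXsubC subrr mul0r addr0.
have /eqP -> : root (\prod_(j <- rem z (poly_roots p)) ('X - j%:P)) z.
  by rewrite root_prod_XsubC.
by rewrite mulr0.
Qed.

Lemma near_all (T : Type) (I : eqType) (F : set_system T) (FF : Filter F) (s : seq I)
    (P : I -> T -> Prop) :
  (forall i, i \in s -> \forall e \near F, P i e) ->
  \forall e \near F, forall i, i \in s -> P i e.
Proof.
elim: s => [|x s IH] H; first by near=> e.
have H1 := H x (mem_head _ _).
have H2 : \forall e \near F, forall i, i \in s -> P i e.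
  by apply: IH => i si; apply: H; rewrite in_cons si orbT.
by apply: filterS2 H1 H2 => e Px Ps i; rewrite in_cons => /predU1P[->|/Ps].
Unshelve. all: by end_near. Qed.

(** For [g1 <= g2], the difference divided by [e^g1] tends to [z1 - z2] if the slopes agree and to
    [z1] otherwise; neither limit is 0. *)
Lemma near_distinct (R : realType) (f1 f2 : R -> R[i]) (g1 g2 : R) (z1 z2 : R[i]) :
  tends (0 : R)^'+ (fun e => (e `^ (- g1))%:C * f1 e) z1 ->
  tends (0 : R)^'+ (fun e => (e `^ (- g2))%:C * f2 e) z2 ->
  z1 != 0 -> z2 != 0 -> (g1, z1) != (g2, z2) ->
  \forall e \near (0 : R)^'+, f1 e != f2 e.
Proof.
wlog g12 : f1 f2 g1 g2 z1 z2 / g1 <= g2 => [H|].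
  have [/H|/ltW/H {}H] := leP g1 g2; first exact.
  move=> t1 t2 z10 z20 ne; rewrite eq_sym in ne.
  by have := H _ _ _ _ t2 t1 z20 z10 ne; apply: filterS => e; rewrite eq_sym.
move=> t1 t2 z10 z20 ne; rewrite -subr_ge0 in g12.
have F0 : Filter (0 : R)^'+ by exact: _.
have t := tendsD F0 t1 (tendsM F0 (@tends_cst _ _ _ F0 (- 1)) (tendsM F0 (powR_tends0 g12) t2)).
have lim0 : z1 + (- 1) * ((g2 - g1 == 0)%:R * z2) != 0.
  rewrite mulN1r subr_eq0; have [e|_] := eqVneq (g2 - g1) 0; last by rewrite mul0r.
  by rewrite mul1r; apply: contra_neq ne => ->; rewrite (subr0_eq e).
have := tends_neq0 F0 lim0 t; apply: filterS2 (nbhs_right_gt 0) => e e0.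
apply: contra_neq => ->.
rewrite mulN1r mulrA -rmorphM -powRD_gt0 //.
by rewrite (_ : g2 - g1 + - g2 = - g1) ?subrr // addrAC subrr add0r.
Qed.

(** Every monomial of such an exponent contains an entry with exponent [+oo]. The finitely many
    entries of this kind vanish on a common interval, hence the uniformity in [l]. *)
Lemma coef_near0 (R : realType) n d (A : 'I_d.+1 -> 'M[\bar R]_n)
    (y : 'I_d.+1 * 'I_n * 'I_n -> R[i]) (F : 'I_d.+1 -> 'M[R -> R[i]]_n) :
  (forall k i j, A k i j != -oo%E) ->
  (forall k i j, asymp (F k i j) (y (k, i, j)) (A k i j)) ->
  \forall e \near (0 : R)^'+, forall l, mp_charcoef A l = +oo%E ->
    (char_poly_of (matgerm_at F e))`_l = 0.
Proof.
move=> ANy Fy.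
have H : \forall e \near (0 : R)^'+, forall x : 'I_d.+1 * 'I_n * 'I_n,
    A x.1.1 x.1.2 x.2 = +oo%E -> F x.1.1 x.1.2 x.2 e = 0.
  apply: filter_forall => -[[k i] j] /=.
  have [Aoo|Aoo] := eqVneq (A k i j) +oo%E.
    by have := Fy k i j; rewrite /asymp Aoo; apply: filterS.
  by near=> e => Aoo'; rewrite Aoo' eqxx in Aoo.
apply: filterS H => e H l cl; rewrite coef_matgerm big1 // => s _.
rewrite big1 // => k /eqP kl.
have := mp_charcoef_le A s k; rewrite kl cl leye_eq => /eqP/esum_eqyP.
case=> [i _|i [_ _ Ai]]; first exact: ANy.
by rewrite (bigD1 i) //= (H (k i, i, s i)) // mul0r mulr0.
Unshelve. all: by end_near. Qed.

Lemma coef_near_neq0 (R : realType) n d (A : 'I_d.+1 -> 'M[\bar R]_n)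
    (y : 'I_d.+1 * 'I_n * 'I_n -> R[i]) (F : 'I_d.+1 -> 'M[R -> R[i]]_n) (g : R) l :
  (forall k i j, A k i j != -oo%E) -> mp_regular A ->
  generic_entries y ->
  (forall k i j, asymp (F k i j) (y (k, i, j)) (A k i j)) ->
  (char_poly_of (coef_on (active_entries A g (Opt (mp_hat A g))) y))`_l != 0 ->
  \forall e \near (0 : R)^'+, (char_poly_of (matgerm_at F e))`_l != 0.
Proof.
move=> ANy Areg ygen Fy pl.
have GE : opt_or_sat (mp_hat A g) (Opt (mp_hat A g)) by left.
have [v [le_v monE _ _ _]] := active_range ANy Areg GE.
have F0 : Filter (0 : R)^'+ by exact: _.
have := tends_neq0 F0 pl (rescale_tends ANy Fy le_v monE).
by apply: filterS => e /rescale_neq0.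
Qed.

(** No finite root exceeds [g1] and none is below [g2], so the lower active exponent at [g1] is the
    valuation and the upper one at [g2] is the degree; both coefficients remain nonzero for small
    [e]. *)
Lemma char_poly_matgerm_near (R : realType) n d (A : 'I_d.+1 -> 'M[\bar R]_n)
    (y : 'I_d.+1 * 'I_n * 'I_n -> R[i]) (F : 'I_d.+1 -> 'M[R -> R[i]]_n) :
  (forall k i j, A k i j != -oo%E) -> mp_regular A ->
  generic_entries y ->
  (forall k i j, asymp (F k i j) (y (k, i, j)) (A k i j)) ->
  \forall e \near (0 : R)^'+, let P := char_poly_of (matgerm_at F e) in
    [/\ P != 0, valuation 0 P = mp_val (mp_charpoly A),
        poly_deg P = mp_deg (mp_charpoly A),
        size (poly_roots P) = mp_deg (mp_charpoly A) &
        count_mem 0 (poly_roots P) = mp_val (mp_charpoly A)].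
Proof.
move=> ANy Areg ygen Fy; have [l0 l0P] := Areg.
have PNy l : nth +oo%E (mp_charpoly A) l != -oo%E.
  by rewrite nth_mp_charpoly mp_charcoef_neqNy.
rewrite -nth_mp_charpoly in l0P.
have fc := mp_factorization_mp_roots PNy l0P.
have [valE [g1 g1P]] := mp_large_slope PNy (mp_deg_finite l0P) fc.
have [sc _ cN _] := fc.
have [g2 g2P] := mp_small_slope cN.
have GE g : opt_or_sat (mp_hat A g) (Opt (mp_hat A g)) by left.
have [_ plo _ _] := char_poly_active ANy Areg (GE g1) ygen.
have [_ _ phi _] := char_poly_active ANy Areg (GE g2) ygen.
rewrite g1P -valE in plo; rewrite g2P sc in phi.
have nlo := coef_near_neq0 ANy Areg ygen Fy plo.
have nhi := coef_near_neq0 ANy Areg ygen Fy phi.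
have nz := coef_near0 ANy Fy.
apply: filterS3 nz nlo nhi => e Pz Plo Phi /=; set P := char_poly_of _ in Pz Plo Phi *.
have Pr l : P`_l != 0 -> (mp_val (mp_charpoly A) <= l <= mp_deg (mp_charpoly A))%N.
  move=> Pl; have cl : nth +oo%E (mp_charpoly A) l != +oo%E.
    by rewrite nth_mp_charpoly; apply: contra_neq Pl; exact: Pz.
  rewrite mp_deg_max // andbT /mp_val /valuation leqNgt; apply/negP.
  by move=> /(before_find +oo%E); rewrite cl.
have [e1 e2 e3 e4] := poly_range_facts Pr Plo Phi.
by split=> //; apply: contraNneq Plo => ->; rewrite coef0.
Qed.

Lemma count_mem_fine (R : realType) (c : seq (\bar R)) (g : R) :
  count_mem g [seq fine x | x <- c & x \is a fin_num] = count_mem g%:E c.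
Proof.
rewrite count_map count_filter; apply: eq_count => x /=.
by case: x => [a| |] //=; rewrite ?andbT ?andbF.
Qed.

Lemma sum_count_undup (T : eqType) (s : seq T) :
  sumn [seq count_mem x s | x <- undup s] = size s.
Proof.
rewrite -[RHS](perm_size (perm_count_undup s)) size_flatten /shape -map_comp.
by congr sumn; apply: eq_map => x /=; rewrite size_nseq.
Qed.

Lemma is_germ0 (R : realType) : is_germ (fun _ : R => 0 : R[i]).
Proof.
exists 1; split; first exact: ltr01.
split=> [e _|]; first exact: tends_cst.
by exists 1 => // e _; rewrite normr0 lecR powR_ge0.
Qed.

Lemma eigenvalues_first_order (R : realType) n d (A : 'I_d.+1 -> 'M[\bar R]_n)
    (y : 'I_d.+1 * 'I_n * 'I_n -> R[i]) (F : 'I_d.+1 -> 'M[R -> R[i]]_n) :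
  (forall k i j, A k i j != -oo%E) -> mp_regular A ->
  generic_entries y -> (forall k i j, is_germ (F k i j)) ->
  (forall k i j, asymp (F k i j) (y (k, i, j)) (A k i j)) ->
  eigenvalues_have_first_order_asymptotics F.
Proof.
move=> ANy Areg ygen Fgerm Fy; have [l0 l0P] := Areg.
have PNy l : nth +oo%E (mp_charpoly A) l != -oo%E.
  by rewrite nth_mp_charpoly mp_charcoef_neqNy.
rewrite -nth_mp_charpoly in l0P.
have fc := mp_factorization_mp_roots PNy l0P.
have [valE _] := mp_large_slope PNy (mp_deg_finite l0P) fc.
have [sc _ cN _] := fc.
set c := mp_roots (mp_charpoly A) in fc valE sc cN.
have GE g : opt_or_sat (mp_hat A g) (Opt (mp_hat A g)) by left.
pose p g := char_poly_of (coef_on (active_entries A g (Opt (mp_hat A g))) y).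
pose Z g := [seq z <- poly_roots (p g) | z != 0].
pose fins := [seq fine x | x <- c & x \is a fin_num].
(* Each slope is listed once: its multiplicity reappears as the number of nonzero roots of [p g]. *)
pose L := [seq (g, z) | g <- undup fins, z <- Z g].
have pP g : [/\ simple_nonzero_roots (p g) & size (Z g) = count_mem g%:E c].
  have [pl plo phi ps] := char_poly_active ANy Areg (GE g) ygen; split=> //.
  have [_ _ psz pc0] := poly_range_facts pl plo phi.
  by rewrite size_filter count_neq0 psz pc0 count_ge_eq addnK.
have uL : uniq L.
  apply: allpairs_uniq_dep; rewrite ?undup_uniq //.
    by move=> g _; apply: uniq_nonzero_roots; case: (pP g).
  by move=> [g z] [g' z'] /= _ _ [-> ->].
(* Together with the zero branches, [L] accounts for as many roots as the degree allows. *)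
have sL : mp_deg (mp_charpoly A) = (mp_val (mp_charpoly A) + size L)%N.
  rewrite size_allpairs_dep valE -sc -(count_predC (pred1 +oo%E) c); congr (_ + _)%N.
  transitivity (size fins).
    rewrite size_map size_filter; apply: eq_in_count => x xc /=.
    have xN : x != -oo%E by apply: contraNneq cN => <-.
    by rewrite fin_numE xN.
  rewrite -sum_count_undup; congr sumn; apply: eq_map => g.
  by case: (pP g) => _ ->; rewrite count_mem_fine.
have LP x : x \in L -> x.2 != 0 /\ root (p x.1) x.2.
  case/allpairsPdep => g [z [_ zZ ->]] /=; move: zZ; rewrite mem_filter => /andP[z0 zr].
  by split=> //; rewrite -mem_poly_roots //; case: (pP g) => -[].
have /choice[br brP] : forall x : R * R[i], exists f : R -> R[i], x \in L ->
    [/\ is_germ f, tends (0 : R)^'+ (fun e => (e `^ (- x.1))%:C * f e) x.2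
    & \forall e \near (0 : R)^'+, root (char_poly_of (matgerm_at F e)) (f e)].
  move=> x; have [xL|xL] := boolP (x \in L); last by exists (fun=> 0).
  have [x0 px] := LP x xL.
  by have [f fP] := eigen_branch ANy Areg ygen Fgerm Fy (GE x.1) x0 px; exists f.
have F0 : Filter (0 : R)^'+ by exact: _.
set v := mp_val (mp_charpoly A) in valE sL.
pose br0 : R -> R[i] := fun=> 0.
pose brs := nseq v br0 ++ [seq br x | x <- L].
have nthE i : (i < size brs)%N ->
    nth br0 brs i = br0 \/ exists2 x, x \in L & nth br0 brs i = br x.
  rewrite size_cat nth_cat size_nseq size_map => iL.
  have [iv|iv] := ltnP i v; first by left; rewrite nth_nseq iv.
  have iL' : (i - v < size L)%N by rewrite ltn_subLR.
  right; exists (nth (0, 0) L (i - v)); first exact: mem_nth.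
  by rewrite (nth_map (0, 0)).
exists brs; split.
- move=> i /nthE[->|[x xL ->]]; first exact: is_germ0.
  by case: (brP x xL).
- have roots_near : \forall e \near (0 : R)^'+, forall x, x \in L ->
      root (char_poly_of (matgerm_at F e)) (br x e) /\ br x e != 0.
    apply: near_all => x xL; have [_ tx rx] := brP x xL.
    have := tends_neq0 F0 (LP x xL).1 tx; apply: filterS2 rx => e rx b; split=> //.
    by apply: contra_neq b => ->; rewrite mulr0.
  have dist_near : \forall e \near (0 : R)^'+, forall x, x \in L -> forall x', x' \in L ->
      x != x' -> br x e != br x' e.
    apply: near_all => x xL; apply: near_all => x' x'L.
    have [->|xx'] := eqVneq x x'; first by near=> e.
    have [_ tx _] := brP x xL; have [_ tx' _] := brP x' x'L.
    have := near_distinct tx tx' (LP x xL).1 (LP x' x'L).1.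
    rewrite -!surjective_pairing => /(_ xx'); exact: filterS.
  have := char_poly_matgerm_near ANy Areg ygen Fy.
  apply: filterS3 roots_near dist_near => e rP dP /= [P0 _ _ szP c0P].
  rewrite map_cat map_nseq -map_comp; apply: perm_eq_nseq_uniq.
  + rewrite map_inj_in_uniq // => x x' xL x'L /= e12; apply/eqP; apply: contraT.
    by move=> /(dP x xL x' x'L); rewrite e12 eqxx.
  + by apply/negP => /mapP[x xL /= e0]; have [_] := rP x xL; rewrite -e0 eqxx.
  + by move=> _ /mapP[x xL ->]; rewrite mem_poly_roots //; case: (rP x xL).
  + exact: c0P.
  + by rewrite size_map /eigenvalues szP.
move=> i /nthE[->|[x xL ->]].
  by exists 0, +oo%E; split; [near=> e | right].
have [_ tx _] := brP x xL; exists x.2, x.1%:E; split; first exact: tx.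
by left; split=> //; case: (LP x xL).
Unshelve. all: by end_near. Qed.

Theorem theorem8p3 (R : realType) (n d : nat) (A : 'I_d.+1 -> 'M[\bar R]_n)
    (A_Rmin : forall k i j, A k i j != -oo%E) (A_regular : mp_regular A) :
  generic (fun y : 'I_d.+1 * 'I_n * 'I_n -> R[i] =>
    let a : 'I_d.+1 -> 'M[R[i]]_n := fun k => \matrix_(i, j) y (k, i, j) in
    forall F : 'I_d.+1 -> 'M[R -> R[i]]_n,
      (forall k i j, is_germ (F k i j)) ->
      (forall k i j, asymp (F k i j) (a k i j) (A k i j)) ->
      [/\ regular_germ F,
          eigenvalues_have_first_order_asymptotics F,
          (\forall e \near (0 : R)^'+,
             char_poly_of (matgerm_at F e) != 0 /\
             valuation 0 (char_poly_of (matgerm_at F e))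
               = mp_val (mp_charpoly A) /\
             count_mem 0 (eigenvalues (matgerm_at F e)) = mp_mult A +oo%E),
          (\forall e \near (0 : R)^'+,
             char_poly_of (matgerm_at F e) != 0 /\
             poly_deg (char_poly_of (matgerm_at F e))
               = mp_deg (mp_charpoly A) /\
             mult_infty (matgerm_at F e) = mp_mult A -oo%E)
        & forall (g : R) (G : rel 'I_n),
            (0 < mp_mult A g%:E)%N ->
            (G = Opt (mp_hat A g) \/
             exists U V : 'I_n -> R,
               hungarian_pair (mp_hat A g) U V /\ G = Sat (mp_hat A g) U V) ->
            let m := mp_mult A g%:E in
            let m' := mp_mult_gt A g in
            let m'' := (n * d - m - m')%N in
            let ag := a_gamma A a g G in
            [/\ char_poly_of ag != 0,
                count (fun z => z != 0) (eigenvalues ag) = m,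
                valuation 0 (char_poly_of ag) = m',
                count_mem 0 (eigenvalues ag) = m'
              & mult_infty ag = m'']]).
Proof.
have [Q [Q0 QP]] := @generic_generic_entries R[i] n d.
exists Q; split=> // y /QP ygen a F Fgerm Fa.
have Fy k i j : asymp (F k i j) (y (k, i, j)) (A k i j).
  by have := Fa k i j; rewrite mxE.
have near0 := char_poly_matgerm_near A_Rmin A_regular ygen Fy.
have valE : mp_mult A +oo%E = mp_val (mp_charpoly A).
  have [l0 l0P] := A_regular.
  have PNy l : nth +oo%E (mp_charpoly A) l != -oo%E.
    by rewrite nth_mp_charpoly mp_charcoef_neqNy.
  rewrite -nth_mp_charpoly in l0P.
  have fc := mp_factorization_mp_roots PNy l0P.
  by have [-> _] := mp_large_slope PNy (mp_deg_finite l0P) fc.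
split.
- move=> P0; near (0 : R)^'+ => e.
  have [] : char_poly_of (matgerm_at F e) != 0 /\ char_poly_of (matgerm_at F e) = 0.
    by split; near: e => //; apply: filterS near0 => e [].
  by move=> /eqP.
- exact: eigenvalues_first_order ygen Fgerm Fy.
- by apply: filterS near0 => e [-> -> _ _ c0]; rewrite valE.
- by apply: filterS near0 => e [-> _ dE _ _]; rewrite /mult_infty dE.
by move=> g G _ GE m m' m'' ag; rewrite /ag a_gammaE; apply: a_gamma_eigenvalues.
Unshelve. all: by end_near. Qed.
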